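(* Let $S\subseteq(0;1)$ be analytic and let $\mathcal{R}_S=\{K\in\mathbf{K}:\operatorname{ran}\mathcal{D}_K=S\cup\{0,1\}\}$. Then $\mathcal{R}_S$ is $\boldsymbol{\Pi}^1_1$-complete if $S=\emptyset$; it is $2$-$\boldsymbol{\Sigma}^1_1$-complete if $S\neq\emptyset$ is countable; and it is $\boldsymbol{\Pi}^1_2$-complete if $S$ is uncountable.
   Context: $2^{\omega}$ is the Cantor space; $N_s=\{x\in 2^\omega:s\subset x\}$; $\mu$ is the coin-tossing measure with $\mu(N_s)=2^{-\mathrm{lh}(s)}$. For measurable $A$, $\mathcal{D}_A(z)=\lim_n\mu(A\cap N_{z\restriction n})/\mu(N_{z\restriction n})$ when the limit exists; $\operatorname{ran}\mathcal{D}_A$ is the set of values attained where defined. $\mathbf{K}$ is the Polish space of compact subsets of $2^\omega$ with the Vietoris topology. $2$-$\boldsymbol{\Sigma}^1_1$ is the class of sets of the form $A\cap B$ with $A$ analytic and $B$ coanalytic. For a boldface pointclass $\boldsymbol{\Gamma}$, $A\subseteq X$ is $\boldsymbol{\Gamma}$-complete if $A\in\boldsymbol{\Gamma}(X)$ and for every zero-dimensional Polish $Z$ and $B\in\boldsymbol{\Gamma}(Z)$ there is a continuous $f:Z\to X$ with $B=f^{-1}(A)$. *)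

(* Defs.v *)
From HB Require Import structures.
From mathcomp Require Import all_boot all_order all_algebra.
From mathcomp Require Import all_classical all_reals.
From mathcomp Require Import ereal topology normedtype sequences cantor.

Set Implicit Arguments.
Unset Strict Implicit.
Unset Printing Implicit Defensive.

Import Order.TTheory GRing.Theory Num.Theory.
Import numFieldNormedType.Exports.

Local Open Scope classical_set_scope.
Local Open Scope ring_scope.

Definition baire : Type := prod_topology (fun _ : nat => nat).
HB.instance Definition _ := Pointed.on baire.
HB.instance Definition _ := Nbhs.on baire.
HB.instance Definition _ := Topological.on baire.

Definition cyl (s : seq bool) : set cantor_space :=
  [set x | forall i, (i < size s)%N -> x i = nth false s i].

Definition prefix (z : cantor_space) (n : nat) : seq bool := mkseq z n.

Definition Kspace : Type := {A : set cantor_space | compact A}.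
HB.instance Definition _ := gen_eqMixin Kspace.
HB.instance Definition _ := gen_choiceMixin Kspace.

Definition vietoris_sub (p : bool * set cantor_space) : set Kspace :=
  if p.1 then [set K | proj1_sig K `<=` p.2]
  else [set K | proj1_sig K `&` p.2 !=set0].

HB.instance Definition _ :=
  isSubBaseTopological.Build Kspace
    (I := (bool * set cantor_space)%type)
    [set p | open p.2] vietoris_sub.

(** * The coin-tossing measure.
   mu is the (outer) measure generated by mu(N_s) = 2^-lh(s):
   the infimum of sum_i 2^-lh(s_i) over countable covers by basic sets. *)
Definition coin_mu {R : realType} (A : set cantor_space) : \bar R :=
  ereal_inf [set (\sum_(0 <= i <oo) (((2 : R) ^- size (c i))%:E))%E
            | c in [set c : nat -> seq bool | A `<=` \bigcup_i cyl (c i)]].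

(** mu(A ∩ N_{z|n}) / mu(N_{z|n}) *)
Definition dens_seq {R : realType} (A : set cantor_space) (z : cantor_space)
  (n : nat) : R :=
  fine (coin_mu (A `&` cyl (prefix z n))) / ((2 : R) ^- n).

Definition ran_density {R : realType} (A : set cantor_space) : set R :=
  [set r | exists z : cantor_space, dens_seq A z @ \oo --> r].

Definition R_S {R : realType} (S : set R) : set Kspace :=
  [set K | ran_density (proj1_sig K) = S `|` [set r | r = 0 \/ r = 1]].

Definition analytic {T : topologicalType} (A : set T) : Prop :=
  A = set0 \/ exists f : baire -> T, continuous f /\ range f = A.

Definition coanalytic {T : topologicalType} (A : set T) : Prop :=
  analytic (~` A).

Definition d2Sigma11 {T : topologicalType} (A : set T) : Prop :=
  exists B C : set T, analytic B /\ coanalytic C /\ A = B `&` C.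

Definition Sigma12 {T : topologicalType} (A : set T) : Prop :=
  exists B : set (T * baire)%type, coanalytic B /\ A = fst @` B.

Definition Pi12 {T : topologicalType} (A : set T) : Prop :=
  Sigma12 (~` A).

(** * Zero-dimensional Polish spaces.
   Z is given as a complete metric space (its topology is the metric one);
   we require it Hausdorff (so the pseudometric is a metric), separable,
   and zero-dimensional (Hausdorff with a basis of clopen sets). *)
Definition separable (T : topologicalType) : Prop :=
  exists D : set T, countable D /\ closure D = setT.

Definition zero_dim (T : topologicalType) : Prop :=
  hausdorff_space T /\
  forall (x : T) (U : set T), open U -> U x ->
    exists V : set T, clopen V /\ V x /\ V `<=` U.

Definition zd_polish {R : realType} (Z : completePseudoMetricType R) : Prop :=
  hausdorff_space Z /\ separable Z /\ zero_dim Z.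

Definition Gamma_complete {R : realType}
  (Gam : forall T : topologicalType, set T -> Prop)
  (X : topologicalType) (A : set X) : Prop :=
  Gam X A /\
  forall (Z : completePseudoMetricType R), zd_polish Z ->
    forall B : set Z, Gam Z B ->
      exists f : Z -> X, continuous f /\ B = f @^-1` A.

(* Main.v *)
(* Upper bounds. Compact sets are coded by their trees, so K |-> mu(K `&` N_s) is a countable infimum of locally constant functions and "D_K(z) = r" is Borel in all arguments; quantifying over z and over a parametrization of S gives the three classes. For S empty, a path that always follows the denser (the sparser) child has monotone densities and so shows that 0 and 1 are attained as soon as 0 < mu(K) < 1 and the range is included in {0, 1}.

Hardness. Given a continuous phi from the Baire space to (0, 1) and closed sets F_t depending continuously on t, there are compact sets K_t, depending continuously on t, whose density range is {0, 1} together with phi(F_t). A branch y is coded by 0^(y 0) 1 0^(y 1) 1 ... along a null trunk whose nodes have prescribed densities converging to phi(y); mass is compensated in clopen-like parts off the trunk, and parts of the trunk that leave F_t are replaced by such a part of the same density, so the densities do not depend on t. The branches 0^(y 0) 1 ... 1 0 0 0 ... keep oscillating with an amplitude depending on the number of 1s, so they produce no value in (0, 1). All three reductions follow by choosing phi and F_t piecewise; when S is uncountable one reserves a perfect subset of S for coding the universally quantified variable. *)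
Require Import Defs.
From HB Require Import structures.
From mathcomp Require Import all_boot all_order all_algebra.
From mathcomp Require Import all_classical all_reals.
From mathcomp Require Import ereal topology normedtype sequences cantor.
Import Order.TTheory GRing.Theory Num.Theory.
Import numFieldTopology.Exports.
Local Open Scope classical_set_scope.
Local Open Scope ring_scope.
From mathcomp Require Import finmap.
From mathcomp Require Import zify ring lra.
Set Implicit Arguments.
Unset Strict Implicit.
Unset Printing Implicit Defensive.
Import numFieldNormedType.Exports.

(** * Sequence spaces *)

(** For uncountable [S], a quantifier over all [x] must be expressed by one equation between sets of
    reals. The equation itself supplies it: if [h] injects Cantor space into [S], the range contains
    [S] only if every [h w] is attained, and [h w] is made attainable exactly when the [x] coded by
    [w] has a witness; injectivity keeps another [x] from producing the same value. Coding by runs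
    of zeros is imposed by compactness: Baire space is not compact, so the trunk acquires limit
    branches with finitely many 1s, which must be kept from producing values. A density can be
    changed only if the sibling compensates within [0, 1]; hence each bit takes two levels, one
    splitting the trunk at constant density, one on which the trunk keeps a single child and
    corrects its density. [coin_mu] is an outer measure defined by covers; on compact sets it is
    handled as a limit of counts of nodes. Borel sets are represented by [D11], the sets that are
    analytic together with their complement. *)

Definition agree {D : Type} (n : nat) (x y : nat -> D) :=
  forall i, (i < n)%N -> x i = y i.

Lemma mkseq_agree (u v : nat -> nat) (n : nat) :
  mkseq u n = mkseq v n <-> agree n u v.
Proof.
split=> [uv i i_n|uv]; first by rewrite -(nth_mkseq 0%N u i_n) uv nth_mkseq.
by apply/eq_in_map => i; rewrite mem_iota => /uv.
Qed.

Section SequenceSpace.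
Variable D : discreteTopologicalType.
Local Notation X := (prod_topology (fun _ : nat => D)).

Lemma cvg_seqspace (F : set_system X) (x : X) : Filter F ->
  (forall i, F [set y | y i = x i]) -> F --> x.
Proof.
move=> FF Fi; apply/cvg_sup => i U.
rewrite nbhsE => -[_ [[V oV <-]] /= Vx VU].
by apply: filterS (Fi i) => y /= yx; apply: VU; rewrite /= /proj yx.
Qed.

Lemma near_seqspace_coord (x : X) (i : nat) : nbhs x [set y : X | y i = x i].
Proof.
apply: open_nbhs_nbhs; split => //.
have -> : [set y : X | y i = x i] = proj i @^-1` [set x i] by [].
by apply: open_comp; [move=> + _; exact: proj_continuous|exact: discrete_open].
Qed.

Lemma near_agree (x : X) (n : nat) : nbhs x (agree n x).
Proof.
have FF := @nbhs_filter X x.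
elim: n => [|n IH]; first exact: filterE.
apply: filterS2 IH (near_seqspace_coord x n) => z xz /= zn i.
by rewrite ltnS leq_eqVlt => /predU1P[->//|/xz].
Qed.

Lemma nbhs_agreeP (x : X) (U : set X) :
  nbhs x U <-> exists n, forall y, agree n x y -> U y.
Proof.
split=> [xU|[n nU]]; last first.
  by have FF := @nbhs_filter X x; exact: filterS (near_agree x n).
pose F : set_system X := filter_from setT (fun n => agree n x).
have FF : Filter F.
  apply: filter_from_filter; first by exists 0%N.
  move=> i j _ _; exists (maxn i j) => // y xy.
  by split=> k kn; apply: xy; rewrite leq_max kn ?orbT.
have /(_ _ xU)[n _ nU] : F --> x.
  by apply: cvg_seqspace => i; exists i.+1 => // y ->.
by exists n.
Qed.

Lemma open_agreeP (U : set X) :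
  open U <-> forall x, U x -> exists n, forall y, agree n x y -> U y.
Proof.
rewrite openE; split=> [oU x /oU/nbhs_agreeP//|H x /H ?].
exact/nbhs_agreeP.
Qed.

Lemma closed_agreeP (F : set X) :
  closed F <-> forall x, (forall n, exists2 y, agree n x y & F y) -> F x.
Proof.
rewrite -openC open_agreeP; split=> H x.
  move=> Fx; apply: contrapT => /H[n nF].
  by have [y /nF] := Fx n.
move=> Fx; apply: contrapT => /forallNP nF; apply: Fx; apply: H => n.
by have /existsNP[y /not_implyP[xy /contrapT Fy]] := nF n; exists y.
Qed.

Lemma continuous_seqspace (T : topologicalType) (f : T -> X) :
  (forall i t, \forall s \near t, f s i = f t i) -> continuous f.
Proof. by move=> H t; apply: cvg_seqspace => i; apply: H. Qed.

Lemma continuous_coord (T : topologicalType) (f : T -> X) (i : nat) (t : T) :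
  continuous f -> \forall s \near t, f s i = f t i.
Proof. by move=> fc; apply: (fc t _ (near_seqspace_coord (f t) i)). Qed.

End SequenceSpace.

(** * Cylinders and the Vietoris topology *)

Lemma agree_prefix (z y : cantor_space) (n : nat) :
  agree n z y <-> Defs.prefix z n = Defs.prefix y n.
Proof.
split=> [zy|zy i ni]; first by apply/eq_in_map => i; rewrite mem_iota => /zy.
by rewrite -(nth_mkseq false z ni) -/(Defs.prefix z n) zy nth_mkseq.
Qed.

Lemma cylP (s : seq bool) (z : cantor_space) :
  cyl s z <-> Defs.prefix z (size s) = s.
Proof.
split=> [sz|<- i]; last by rewrite size_mkseq => ni; rewrite nth_mkseq.
apply: (@eq_from_nth _ false) => [|i]; rewrite size_mkseq// => si.
by rewrite nth_mkseq// sz.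
Qed.

Lemma cyl_prefix (z : cantor_space) (n : nat) : cyl (Defs.prefix z n) = agree n z.
Proof.
by apply/funext => y; apply/propext; rewrite cylP size_mkseq agree_prefix; split.
Qed.

Lemma prefixS (z : cantor_space) (n : nat) :
  Defs.prefix z n.+1 = rcons (Defs.prefix z n) (z n).
Proof. by rewrite /Defs.prefix mkseqS. Qed.

Lemma cyl_rcons (u : seq bool) (b : bool) (z : cantor_space) :
  cyl (rcons u b) z <-> cyl u z /\ z (size u) = b.
Proof.
rewrite !cylP size_rcons prefixS; split; last by case=> -> ->.
by move=> /eqP; rewrite eqseq_rcons => /andP[/eqP -> /eqP ->].
Qed.

Lemma near_cyl (s : seq bool) (z : cantor_space) :
  \forall y \near z, cyl s y <-> cyl s z.
Proof.
have zs := near_agree (D := bool) z (size s).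
apply: filterS zs => y; rewrite !cylP => /agree_prefix ->.
by [].
Qed.

Lemma open_cyl (s : seq bool) : open (cyl s).
Proof. by rewrite openE => z sz; apply: filterS (near_cyl s z) => y [_]; apply. Qed.

Lemma open_cylC (s : seq bool) : open (~` cyl s).
Proof.
rewrite openE => z sz; apply: filterS (near_cyl s z) => y [ys _].
by move/ys.
Qed.

Lemma closed_cyl (s : seq bool) : closed (cyl s).
Proof. by rewrite -openC; exact: open_cylC. Qed.

(** Boolean, so that surviving nodes can be counted; for closed [A] these are the nodes of its
    tree. *)
Definition hits (A : set cantor_space) (u : seq bool) : bool :=
  `[< A `&` cyl u !=set0 >].

Lemma hitsP (A : set cantor_space) (u : seq bool) :
  reflect (exists2 z, A z & cyl u z) (hits A u).
Proof.
by apply: (iffP (asboolP _)) => [[z [Az uz]]|[z Az uz]]; exists z.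
Qed.

Lemma hitsE (A : set cantor_space) (u : seq bool) :
  hits A u = hits A (rcons u false) || hits A (rcons u true).
Proof.
apply/hitsP/orP => [[z Az uz]|[]/hitsP[z Az /cyl_rcons[uz _]]]; try by exists z.
by case E : (z (size u)); [right|left]; apply/hitsP; exists z => //;
  apply/cyl_rcons.
Qed.

Lemma compact_level (A O : set cantor_space) : compact A -> open O ->
  A `<=` O -> exists n, forall z, A z -> cyl (Defs.prefix z n) `<=` O.
Proof.
move=> /compact_near_coveringP cA oO AO.
have [|n _ nO] := cA _ \oo (fun n z => cyl (Defs.prefix z n) `<=` O) _.
  move=> z Az.
  have /open_agreeP/(_ z (AO _ Az))[n nO] := oO.
  exists (agree n z, [set m | (n <= m)%N]).
    by split; [exact: near_agree|exists n].
  case=> y m /= [zy nm]; rewrite cyl_prefix => x yx; apply: nO => i ni.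
  by rewrite zy// yx// (leq_trans ni).
by exists n => z Az; apply: nO => //=.
Qed.

Lemma cvg_Kspace (F : set_system Kspace) (K : Kspace) : Filter F ->
  (forall p, open p.2 -> vietoris_sub p K -> F (vietoris_sub p)) -> F --> K.
Proof.
move=> FF FK A; rewrite nbhsE => -[_ [[B sB <-] [C BC CK] sUBA]].
rewrite nbhs_filterE; apply: filterS sUBA _; apply: (@filterS _ _ _ C).
  by move=> ? ?; exists C.
have /sB [E sE IEC] := BC; rewrite -IEC; apply: filter_bigI => p Ep.
apply: FK; first by have /set_mem := sE _ Ep.
by move: CK; rewrite -IEC => /(_ p Ep).
Qed.

Lemma nbhs_vietoris_sub (p : bool * set cantor_space) (K : Kspace) :
  open p.2 -> vietoris_sub p K -> nbhs K (vietoris_sub p).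
Proof.
move=> op pK; apply: open_nbhs_nbhs; split => //.
exists [set vietoris_sub p]; last by rewrite bigcup_set1.
move=> _ ->; exists [fset p]%fset; first by move=> q /fset1P ->; apply/mem_set.
by rewrite set_fset1 bigcap_set1.
Qed.

Lemma near_hits (u : seq bool) (K : Kspace) :
  \forall L \near K, hits (proj1_sig L) u = hits (proj1_sig K) u.
Proof.
have [[z Kz uz]|nKu] := hitsP (proj1_sig K) u.
  have : vietoris_sub (false, cyl u) K by exists z.
  move=> /(nbhs_vietoris_sub (p := (false, cyl u)) (open_cyl u)).
  by apply: filterS => L [y [Ly uy]]; apply/hitsP; exists y.
have : vietoris_sub (true, ~` cyl u) K by move=> z Kz uz; apply: nKu; exists z.
move=> /(nbhs_vietoris_sub (p := (true, ~` cyl u)) (open_cylC u)).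
by apply: filterS => L Lu; apply/hitsP => -[y /Lu].
Qed.

(** The values [hits K u] act as clopen coordinates. For inclusion in an open [O], compactness fixes
    a level [n] and only the finitely many nodes of that level matter; for meeting [O], a single
    node inside [O] is enough. *)
Lemma continuous_Kspace (T : topologicalType) (f : T -> Kspace) :
  (forall u t, \forall s \near t,
     hits (proj1_sig (f s)) u = hits (proj1_sig (f t)) u) ->
  continuous f.
Proof.
move=> fu t; apply: cvg_Kspace => -[[] O] /= oO.
  move=> ftO; have [n nO] := compact_level (proj2_sig (f t)) oO ftO.
  have : \forall s \near t, forall v : n.-tuple bool,
      hits (proj1_sig (f s)) v = hits (proj1_sig (f t)) v.
    by apply: filter_forall => v; exact: fu.
  apply: filterS => s sv /= z fsz.
  have sz : size (Defs.prefix z n) == n by rewrite size_mkseq.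
  have /hitsP : hits (proj1_sig (f t)) (Tuple sz).
    by rewrite -sv; apply/hitsP; exists z => //=; rewrite cyl_prefix.
  move=> [y fty]; rewrite cyl_prefix => /agree_prefix zy.
  by apply: (nO y) => //; rewrite cyl_prefix; apply/agree_prefix.
case=> z [ftz Oz].
have /open_agreeP/(_ z Oz)[n nO] := oO.
apply: filterS (fu (Defs.prefix z n) t) => s.
rewrite [in RHS](_ : hits _ _ = true); last first.
  by apply/hitsP; exists z => //; rewrite cyl_prefix.
move=> /hitsP[y fsy]; rewrite cyl_prefix => zy.
by exists y; split => //; exact: nO.
Qed.

(** * Densities of compact sets *)

Fixpoint cnt (P : pred (seq bool)) (u : seq bool) (m : nat) : nat :=
  if m is m'.+1 then (cnt P (rcons u false) m' + cnt P (rcons u true) m')%N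
  else P u.

Section Density.
Variable R : realType.
Implicit Types (A : set cantor_space) (u c : seq bool) (m : nat).

(** The relative measure in [cyl u] of the clopen hull of [A] formed by the nodes [m] levels below
    [u]; for compact [A] it decreases to the density. *)
Definition rcnt A u m : R := (cnt (hits A) u m)%:R / 2 ^+ m.

Lemma rcntS A u m :
  rcnt A u m.+1 = (rcnt A (rcons u false) m + rcnt A (rcons u true) m) / 2.
Proof. by rewrite /rcnt /= natrD exprS; field; rewrite expf_neq0. Qed.

Lemma rcnt_ge0 A u m : 0 <= rcnt A u m.
Proof. by rewrite divr_ge0// exprn_ge0. Qed.

Lemma rcnt_le A u m : rcnt A u m <= (hits A u)%:R.
Proof.
elim: m u => [|m IH] u; first by rewrite /rcnt /= expr0 divr1.
rewrite rcntS ler_pdivrMr// [hits A u]hitsE.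
apply: (le_trans (lerD (IH _) (IH _))).
by case: (hits A _); case: (hits A _) => /=; lra.
Qed.

Lemma rcnt_nonincreasing A u : nonincreasing_seq (rcnt A u).
Proof.
apply/nonincreasing_seqP => m; elim: m u => [|m IH] u.
  by apply: (le_trans (rcnt_le A u 1)); rewrite /rcnt /= expr0 divr1.
by rewrite [leRHS]rcntS [leLHS]rcntS ler_pM2r// lerD.
Qed.

Lemma rcnt_cvg A u : rcnt A u @ \oo --> inf (range (rcnt A u)).
Proof.
apply: nonincreasing_cvgn; first exact: rcnt_nonincreasing.
by exists 0 => _ [m _ <-]; exact: rcnt_ge0.
Qed.

Lemma geometric_tail (k m n : nat) : (m <= n)%N ->
  \sum_(m <= i < n) (2 : R) ^- (i + k) <= 2 * 2 ^- k.
Proof.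
move=> mn.
suff : \sum_(m <= i < n) (2 : R) ^- (i + k) <= 2 * 2 ^- k - 2 * 2 ^- (n + k).
  move/le_trans; apply; rewrite gerBl mulr_ge0// invr_ge0 exprn_ge0//.
elim: n mn => [|n IH]; first by rewrite leqn0 => /eqP ->; rewrite big_geq// subrr.
rewrite leq_eqVlt => /predU1P[->|].
  rewrite big_geq// subr_ge0 ler_pM2l// lef_pV2 ?posrE ?exprn_gt0//.
  by rewrite ler_weXn2l ?ler1n// leq_addl.
rewrite ltnS => mn; rewrite big_nat_recr//=.
have := IH mn; rewrite addSn exprS invfM.
move: (\sum_(m <= i < n) _) (2 ^- (n + k)) (2 ^- k) => x y z; lra.
Qed.

(** Covers in [coin_mu] are infinite sequences of nonempty cylinders, so a finite cover has to be
    padded by cylinders of arbitrarily small total measure. *)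
Lemma coin_mu_le_list A (l : seq (seq bool)) :
  (forall z, A z -> exists2 s, s \in l & cyl s z) ->
  (@coin_mu R A <= (\sum_(s <- l) (2 : R) ^- size s)%:E)%E.
Proof.
move=> Al; apply/lee_addgt0Pr => e e0.
have [k ke] : exists k, 2 * (2 : R) ^- k <= e.
  have [k /= /ltW] := ltr_add_invr (y := 0) (x := e / 2) ltac:(lra).
  rewrite add0r => ke; exists k.
  have : (2 : R) ^- k <= k.+1%:R^-1.
    by rewrite lef_pV2 ?posrE ?exprn_gt0 ?ltr0n// -natrX ler_nat ltn_expl.
  by move=> /le_trans/(_ ke); rewrite ler_pdivlMr// mulrC.
(* Past the end of [l], the default of [nth] gives cylinders of measure 2^-(i+k), of total at most 2
   * 2^-k. *)
pose c i := nth (nseq (i + k) false) l i.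
apply: (@le_trans _ _ (\sum_(0 <= i <oo) ((2 : R) ^- size (c i))%:E)%E).
  apply: ereal_inf_lbound; exists c => // z /Al[s sl sz].
  by exists (index s l) => //; rewrite /c nth_index.
apply: lime_le.
  by apply: is_cvg_nneseries => n _ _; rewrite lee_fin invr_ge0 exprn_ge0.
exists (size l) => // n /= ln.
rewrite sumEFin lee_fin (big_cat_nat (leq0n _) ln)//= lerD//.
  rewrite (big_nth [::]) !big_nat ler_sum// => i /andP[_ il].
  by rewrite /c (set_nth_default [::]).
apply: le_trans ke; apply: le_trans (geometric_tail k ln).
rewrite !big_nat ler_sum// => i /andP[li _].
by rewrite /c nth_default// size_nseq.
Qed.

Fixpoint nodes A u m : seq (seq bool) :=
  if m is m'.+1 then nodes A (rcons u false) m' ++ nodes A (rcons u true) m'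
  else if hits A u then [:: u] else [::].

Lemma coin_mu_le A u m :
  (@coin_mu R (A `&` cyl u) <= (rcnt A u m * 2 ^- size u)%:E)%E.
Proof.
suff <- : \sum_(s <- nodes A u m) (2 : R) ^- size s = rcnt A u m * 2 ^- size u.
  apply: coin_mu_le_list => z [Az uz].
  elim: m u uz => [|m IH] u uz /=.
    have -> : hits A u by apply/hitsP; exists z.
    by exists u; rewrite ?inE.
  have [s su sz] := IH (rcons u (z (size u))) ltac:(exact/cyl_rcons).
  by exists s => //; rewrite mem_cat; case: (z _) su => ->; rewrite ?orbT.
elim: m u => [|m IH] u /=.
  rewrite /rcnt expr0 divr1 /=.
  by case: (hits A u); rewrite ?big_seq1 ?big_nil ?mul1r ?mul0r.
rewrite big_cat/= !IH rcntS !size_rcons exprS; field.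
by rewrite expf_neq0.
Qed.

(** The relative measure of [cyl c] in [cyl u], computed from how the two words compare. *)
Definition lam u c : R :=
  if seq.prefix c u then 1 else
  if seq.prefix u c then 2 ^+ size u / 2 ^+ size c else 0.

Lemma prefix_rconsE u c b :
  seq.prefix c (rcons u b) = seq.prefix c u || (c == rcons u b).
Proof.
apply/idP/orP => [|[cu|/eqP ->]]; last exact: prefix_refl.
  move/prefixP => -[s]; case/lastP: s => [|s b'].
    by rewrite cats0 => ->; rewrite eqxx; right.
  rewrite -rcons_cat => /eqP; rewrite eqseq_rcons => /andP[/eqP -> _].
  by left; exact: prefix_prefix.
by apply: prefix_trans cu _; exact: prefix_rcons.
Qed.

Lemma lam_le u c : lam u c <= 2 ^+ size u / 2 ^+ size c.
Proof.
rewrite /lam; case: ifPn => [/size_prefix cu|_]; last first.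
  by case: ifP => // _; rewrite divr_ge0 ?exprn_ge0.
by rewrite ler_pdivlMr ?exprn_gt0// mul1r ler_weXn2l ?ler1n.
Qed.

Lemma lam_split u c : lam (rcons u false) c + lam (rcons u true) c <= 2 * lam u c.
Proof.
have [cu|ncu] := boolP (seq.prefix c u).
  by rewrite /lam cu !prefix_rconsE cu /=; lra.
have [uc|nuc] := boolP (seq.prefix u c); last first.
  have F b : seq.prefix c (rcons u b) = false.
    rewrite prefix_rconsE (negbTE ncu) /=; apply/negbTE; apply: contra nuc.
    by move/eqP => ->; exact: prefix_rcons.
  have G b : seq.prefix (rcons u b) c = false.
    by apply/negbTE; apply: contra nuc; apply: prefix_trans; exact: prefix_rcons.
  by rewrite /lam !F !G (negbTE ncu) (negbTE nuc); lra.
have luc : lam u c = 2 ^+ size u / 2 ^+ size c by rewrite /lam (negbTE ncu) uc.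
move: uc => /prefixP[s cE].
case: s cE => [|b s] cE; first by rewrite cE cats0 prefix_refl in ncu.
have lb : lam (rcons u b) c <= 2 * (2 ^+ size u / 2 ^+ size c).
  by apply: le_trans (lam_le _ _) _; rewrite size_rcons exprS mulrA.
have lnb : lam (rcons u (~~ b)) c = 0.
  rewrite /lam prefix_rconsE (negbTE ncu) /= cE.
  have -> : (u ++ b :: s == rcons u (~~ b)) = false.
    by rewrite -cats1 eqseq_cat// eqxx; case: b {cE lb}; case: s.
  by rewrite -cats1 prefix_catr// eqxx prefix_cons; case: b {cE lb}.
by rewrite luc; case: b {cE} lb lnb => lb lnb; rewrite lnb ?addr0 ?add0r.
Qed.

(** Subadditivity by descent through the tree: [lam_split] passes the bound from the children to the
    node, and at the bottom every [c i] is so short that meeting the node means containing it. *)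
Lemma rcnt_cover A (c : nat -> seq bool) (N : nat) u m :
  (forall z, A z -> cyl u z -> exists2 i, (i < N)%N & cyl (c i) z) ->
  (forall i, (i < N)%N -> size (c i) <= size u + m)%N ->
  rcnt A u m <= \sum_(0 <= i < N) lam u (c i).
Proof.
have lam_ge0 v d : 0 <= lam v d.
  by rewrite /lam; case: ifP => // _; case: ifP => // _; rewrite divr_ge0 ?exprn_ge0.
elim: m u => [|m IH] u Ac cu.
  rewrite /rcnt expr0 divr1 /=; have [[z Az uz]|_] := hitsP A u; last first.
    by rewrite sumr_ge0.
  have [i iN /cylP ciz] := Ac z Az uz.
  rewrite big_mkord (bigD1 (Ordinal iN))//=.
  have -> : lam u (c i) = 1.
    rewrite /lam; suff -> : seq.prefix (c i) u by [].
    have := cu _ iN; rewrite addn0 => ciu.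
    rewrite prefixE -{2}ciz; apply/eqP.
    move/cylP : uz => <-; rewrite /Defs.prefix -map_take take_iota.
    by rewrite (minn_idPl _).
  by rewrite lerDl sumr_ge0.
rewrite rcntS ler_pdivrMr// mulrC mulr_sumr.
apply: le_trans (ler_sum _ (fun i _ => lam_split u (c i))).
rewrite big_split/= lerD// IH// => [z Az /cyl_rcons[uz _]|i iN|z Az /cyl_rcons[uz _]|i iN];
  by [exact: Ac|rewrite size_rcons addSnnS cu].
Qed.

(** Compactness leaves finitely many cylinders of the cover; their maximal length provides a level
    at which [rcnt_cover] applies. *)
Lemma coin_mu_ge A u : compact A ->
  ((inf (range (rcnt A u)) * 2 ^- size u)%:E <= @coin_mu R (A `&` cyl u))%E.
Proof.
move=> cA; apply/ereal_infP => _ [c Auc <-].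
have /compact_near_coveringP cAu : compact (A `&` cyl u).
  by apply: compact_closedI => //; exact: closed_cyl.
have [|N _ /(_ _ (leqnn N)) NA] := cAu _ \oo
    (fun n z => exists2 i, (i < n)%N & cyl (c i) z) _.
  move=> z /Auc[i _ ciz]; exists (cyl (c i), [set n | (i < n)%N]).
    split; last by exists i.+1.
    by apply: open_nbhs_nbhs; split => //; exact: open_cyl.
  by move=> -[y n] /= [ciy iltn]; exists i.
pose m := (\max_(i < N) size (c i))%N.
apply: (@le_trans _ _ (\sum_(0 <= i < N) ((2 : R) ^- size (c i))%:E)%E); last first.
  by apply: nneseries_lim_ge => n _ _; rewrite lee_fin invr_ge0 exprn_ge0.
rewrite sumEFin lee_fin ler_pdivrMr ?exprn_gt0//.
apply: (@le_trans _ _ (rcnt A u m)).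
  by apply: ge_inf; [exists 0 => _ [k _ <-]; exact: rcnt_ge0|exists m].
apply: le_trans (@rcnt_cover A c N u m _ _) _.
- by move=> z Az uz; exact: NA.
- move=> i iN; apply: (leq_trans _ (leq_addl _ _)).
  exact: (leq_bigmax (Ordinal iN)).
by rewrite mulr_suml; apply: ler_sum => i _; rewrite mulrC; exact: lam_le.
Qed.

Definition rdens A u : R := fine (coin_mu (A `&` cyl u)) / 2 ^- size u.

Lemma dens_seqE A (z : cantor_space) (n : nat) :
  dens_seq A z n = rdens A (Defs.prefix z n).
Proof. by rewrite /dens_seq /rdens size_mkseq. Qed.

Section Compact.
Variables (A : set cantor_space) (cA : compact A).

Lemma rdensE u : rdens A u = inf (range (rcnt A u)).
Proof.
rewrite /rdens.
suff -> : @coin_mu R (A `&` cyl u) = (inf (range (rcnt A u)) * 2 ^- size u)%:E.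
  by rewrite /= mulfK// invr_neq0// expf_neq0.
apply/eqP; rewrite eq_le coin_mu_ge// andbT.
have fm : @coin_mu R (A `&` cyl u) \is a fin_num.
  rewrite fin_numE; apply/andP; split.
    by apply/negP => /eqP muE; have := coin_mu_ge u cA; rewrite muE.
  by apply/negP => /eqP muE; have := coin_mu_le A u 0; rewrite muE.
rewrite -(fineK fm) lee_fin -ler_pdivrMr ?invr_gt0 ?exprn_gt0//.
apply: lb_le_inf; first by exists (rcnt A u 0), 0%N.
move=> _ [m _ <-]; rewrite ler_pdivrMr ?invr_gt0 ?exprn_gt0// -lee_fin fineK//.
exact: coin_mu_le.
Qed.

Lemma rcnt_cvg_rdens u : rcnt A u @ \oo --> rdens A u.
Proof. by rewrite rdensE; exact: rcnt_cvg. Qed.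

(** The form used for complexity: a strict upper bound on a density is witnessed at a finite level,
    hence is an open condition on the compact set. *)
Lemma rdens_lt u (q : R) : rdens A u < q <-> exists m, rcnt A u m < q.
Proof.
have lb : has_lbound (range (rcnt A u)).
  by exists 0 => _ [k _ <-]; exact: rcnt_ge0.
split=> [|[m]]; last first.
  by apply: le_lt_trans; rewrite rdensE; apply: ge_inf => //; exists m.
rewrite rdensE => /inf_lt[|_ [m _ <-] mq]; last by exists m.
by exists (rcnt A u 0), 0%N.
Qed.

Lemma rdens_ge0 u : 0 <= rdens A u.
Proof.
rewrite rdensE; apply: lb_le_inf; first by exists (rcnt A u 0), 0%N.
by move=> _ [m _ <-]; exact: rcnt_ge0.
Qed.

Lemma rdens_le u : rdens A u <= (hits A u)%:R.
Proof.
rewrite rdensE; apply: (@le_trans _ _ (rcnt A u 0)); last exact: rcnt_le.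
by apply: ge_inf; [exists 0 => _ [k _ <-]; exact: rcnt_ge0|exists 0%N].
Qed.

(** Obtained as the limit of [rcntS], without appeal to additivity of [coin_mu]. *)
Lemma rdens_split u :
  rdens A u = (rdens A (rcons u false) + rdens A (rcons u true)) / 2.
Proof.
have h1 : rcnt A u m.+1 @[m --> \oo] --> rdens A u.
  by rewrite (cvg_shiftS (rcnt A u)); exact: rcnt_cvg_rdens.
have h2 : (rcnt A (rcons u false) m + rcnt A (rcons u true) m) / 2
    @[m --> \oo] --> (rdens A (rcons u false) + rdens A (rcons u true)) / 2.
  apply: cvgMr_tmp.
  exact: (cvgD (@rcnt_cvg_rdens (rcons u false)) (@rcnt_cvg_rdens (rcons u true))).
rewrite (_ : (fun m => _) = rcnt A u \o S) in h2; last first.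
  by apply/funext => m /=; rewrite rcntS.
exact: (@norm_cvg_unique _ R^o _ _ _ _ h1 h2).
Qed.

End Compact.
End Density.

(** * Projections of closed sets *)

Lemma continuous_pair (X T U : topologicalType) (f : X -> T) (g : X -> U) :
  continuous f -> continuous g -> continuous (fun x => (f x, g x)).
Proof.
move=> fc gc x W [[P Q] [/= fP gQ] PQW].
have fP' : \forall y \near x, P (f y) := fc x _ fP.
have gQ' : \forall y \near x, Q (g y) := gc x _ gQ.
by apply: filterS2 fP' gQ' => y Pf Qg; apply: PQW.
Qed.

Lemma continuous_fst (T U : topologicalType) : continuous (@fst T U).
Proof. by move=> x; exact: cvg_fst. Qed.

Lemma continuous_snd (T U : topologicalType) : continuous (@snd T U).
Proof. by move=> x; exact: cvg_snd. Qed.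

Lemma continuous_comp_fun (X T U : topologicalType) (f : X -> T) (g : T -> U) :
  continuous f -> continuous g -> continuous (fun x => g (f x)).
Proof. by move=> fc gc x; apply: continuous_comp; [exact: fc|exact: gc]. Qed.

Definition reindex {D : Type} (g : nat -> nat) (y : nat -> D) : nat -> D :=
  fun i => y (g i).

Lemma continuous_reindex (g : nat -> nat) :
  continuous (reindex g : baire -> baire).
Proof.
apply: (@continuous_seqspace nat) => i y.
exact: (@near_seqspace_coord nat y (g i)).
Qed.

Definition pair_code (i j : nat) : nat := choice.pickle (i, j).

Definition slice {D : Type} (i : nat) : (nat -> D) -> nat -> D :=
  reindex (pair_code i).

Definition unslice {D : Type} (x0 : D) (ys : nat -> nat -> D) : nat -> D :=
  fun k => if @choice.unpickle (nat * nat)%type k is Some p then ys p.1 p.2 else x0.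

Lemma unsliceK {D : Type} (x0 : D) (ys : nat -> nat -> D) (i : nat) :
  slice i (unslice x0 ys) = ys i.
Proof.
by apply/funext => j; rewrite /slice /reindex /unslice /pair_code choice.pickleK.
Qed.

Definition tail {D : Type} : (nat -> D) -> nat -> D := reindex S.

Definition push {D : Type} (x : D) (y : nat -> D) : nat -> D :=
  fun i => if i is j.+1 then y j else x.

Lemma continuous_slice (i : nat) : continuous (slice i : baire -> baire).
Proof. exact: continuous_reindex. Qed.

Lemma continuous_slice_snd (T : topologicalType) (i : nat) :
  continuous (fun p : T * baire => slice i p.2 : baire).
Proof.
exact: (@continuous_comp_fun _ baire baire _ _ (@continuous_snd _ _)
  (@continuous_slice i)).
Qed.

Lemma continuous_tail_snd (T : topologicalType) :
  continuous (fun p : T * baire => tail p.2 : baire).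
Proof.
exact: (@continuous_comp_fun _ baire baire _ _ (@continuous_snd _ _)
  (@continuous_reindex S)).
Qed.

(** * Closure properties of analytic and bianalytic sets *)

Section Classes.
Variable T : topologicalType.
Implicit Types A B : set T.

(** Projections of closed sets make sense over every [T] and have direct closure properties;
    [S11_analytic] converts them into continuous images of Baire space. *)
Definition S11 A := exists F : set (T * baire)%type,
  closed F /\ forall t, A t <-> exists y, F (t, y).

Definition D11 A := S11 A /\ S11 (~` A).

Lemma S11_ext A B : (forall t, A t <-> B t) -> S11 A -> S11 B.
Proof. by move=> AB [F [cF AF]]; exists F; split=> // t; rewrite -AB. Qed.

Lemma S11_closed A : closed A -> S11 A.
Proof.
move=> cA; exists (fst @^-1` A); split.
  by apply: preimage_closed => // x _; exact: continuous_fst.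
by move=> t; split=> [At|[]//]; exists (fun=> 0%N).
Qed.

(** Witnesses for all [n] are stored in the slices of a single sequence. *)
Lemma S11_bigcap (A : nat -> set T) :
  (forall n, S11 (A n)) -> S11 [set t | forall n, A n t].
Proof.
move=> /choice[F FA].
exists (\bigcap_n (fun p : T * baire => (p.1, slice n p.2 : baire)) @^-1` F n).
split=> [|t].
  apply: closed_bigI => n _; apply: preimage_closed; last exact: (FA n).1.
  move=> x _; move: x; apply: continuous_pair; first exact: continuous_fst.
  exact: continuous_slice_snd.
split=> [tA|[y ty] n]; last by apply/(FA n).2; exists (slice n y); exact: ty.
have /choice[y Fy] : forall n, exists y, F n (t, y).
  by move=> n; apply/(FA n).2.
by exists (unslice 0%N y) => n _ /=; rewrite unsliceK.
Qed.

(** The first entry of the new witness names the index; closedness survives because that entry is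
    locally constant. *)
Lemma S11_bigcup (A : nat -> set T) :
  (forall n, S11 (A n)) -> S11 [set t | exists n, A n t].
Proof.
move=> /choice[F FA].
exists [set p | F (p.2 0%N) (p.1, tail p.2)]; split=> [|t].
  rewrite -openC openE => -[t y] /= nF.
  have oF : open (~` ((fun p : T * baire => (p.1, tail p.2 : baire)) @^-1` F (y 0%N))).
    rewrite openC; apply: preimage_closed; last exact: (FA _).1.
    move=> x _; move: x; apply: continuous_pair; first exact: continuous_fst.
    exact: continuous_tail_snd.
  have y0 : \forall p \near (t, y), p.2 0%N = y 0%N :> nat.
    apply: (@continuous_coord nat (T * baire)%type snd 0 (t, y)).
    exact: continuous_snd.
  have nF' : \forall p \near (t, y), ~ F (y 0%N) (p.1, tail p.2).
    by apply: open_nbhs_nbhs; split; first exact: oF.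
  by apply: filterS2 y0 nF' => p /= ->.
split=> [[n /(FA n).2[y Fy]]|[y Fy]]; first by exists (push n y).
by exists (y 0%N); apply/(FA _).2; exists (tail y).
Qed.

Lemma S11_bigcapT (I : countType) (A : I -> set T) :
  (forall i, S11 (A i)) -> S11 [set t | forall i, A i t].
Proof.
move=> SA; apply: S11_ext (S11_bigcap (A := fun n =>
  if choice.unpickle n is Some i then A i else setT) _).
  by move=> t; split=> [tA i|tA n]; [have := tA (choice.pickle i); rewrite choice.pickleK|
    case: choice.unpickle].
by move=> n; case: choice.unpickle => [//|]; apply: S11_closed; exact: closedT.
Qed.

Lemma S11_bigcupT (I : countType) (A : I -> set T) :
  (forall i, S11 (A i)) -> S11 [set t | exists i, A i t].
Proof.
move=> SA; apply: S11_ext (S11_bigcup (A := fun n =>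
  if choice.unpickle n is Some i then A i else set0) _).
  move=> t; split=> [[n]|[i Ai]]; last by exists (choice.pickle i); rewrite choice.pickleK.
  by case: choice.unpickle => // i; exists i.
by move=> n; case: choice.unpickle => [//|]; apply: S11_closed; exact: closed0.
Qed.

Lemma S11_setI A B : S11 A -> S11 B -> S11 (A `&` B).
Proof.
move=> SA SB; apply: S11_ext (S11_bigcapT (A := fun b : bool => if b then A else B) _).
  by move=> t; split=> [AB|[At Bt] []//]; split; [exact: (AB true)|exact: (AB false)].
by case.
Qed.

Lemma S11_setU A B : S11 A -> S11 B -> S11 (A `|` B).
Proof.
move=> SA SB; apply: S11_ext (S11_bigcupT (A := fun b : bool => if b then A else B) _).
  by move=> t; split=> [[[]]|[]]; [left|right|exists true|exists false].
by case.
Qed.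

Lemma D11_S11 A : D11 A -> S11 A. Proof. by case. Qed.

Lemma D11_ext A B : (forall t, A t <-> B t) -> D11 A -> D11 B.
Proof. by move=> AB; rewrite (_ : A = B)//; apply/seteqP; split=> t /AB. Qed.

Lemma D11_C A : D11 A -> D11 (~` A).
Proof. by case=> SA SAC; split=> //; rewrite setCK. Qed.

Lemma D11_bigcap (I : countType) (A : I -> set T) :
  (forall i, D11 (A i)) -> D11 [set t | forall i, A i t].
Proof.
move=> DA; split; first by apply: S11_bigcapT => i; exact: (DA i).1.
apply: S11_ext (S11_bigcupT (fun i => (DA i).2)) => t /=.
by split=> [[i nAi] /(_ i)|/existsNP].
Qed.

Lemma D11_bigcup (I : countType) (A : I -> set T) :
  (forall i, D11 (A i)) -> D11 [set t | exists i, A i t].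
Proof.
move=> DA; split; first by apply: S11_bigcupT => i; exact: (DA i).1.
apply: S11_ext (S11_bigcapT (fun i => (DA i).2)) => t /=.
by split=> [nA [i]|/forallNP//]; exact: nA.
Qed.

Lemma D11_setI A B : D11 A -> D11 B -> D11 (A `&` B).
Proof.
move=> [SA SAC] [SB SBC]; split; first exact: S11_setI.
by rewrite setCI; exact: S11_setU.
Qed.

Lemma D11_near A : (forall t, \forall s \near t, A s <-> A t) -> D11 A.
Proof.
move=> nA; split; apply: S11_closed; rewrite ?closedC -?openC openE => t At;
  by apply: filterS (nA t) => s /= ->.
Qed.

Section Measurable.
Variable R : realType.

Definition meas (f : T -> R) := forall q, D11 [set t | f t < q].

Lemma meas_continuous (f : T -> R) : continuous f -> meas f.
Proof.
move=> fc q; split; last first.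
  apply: S11_closed; rewrite closedC.
  exact: ((continuousP f).1 fc _ (@open_lt R q)).
apply: S11_ext (S11_bigcup (A := fun n t => f t <= q - n.+1%:R^-1) _).
  move=> t; split=> [[n ftn]|ftq].
    by apply: (le_lt_trans ftn); rewrite gtrBl invr_gt0 ltr0n.
  have [n nq] := ltr_add_invr ftq.
  by exists n; rewrite lerBrDr ltW.
move=> n; apply: S11_closed.
exact: ((continuous_closedP f).1 fc _ (@closed_le R _)).
Qed.

Lemma D11_lt_add (f g : T -> R) (e : R) : meas f -> meas g ->
  D11 [set t | f t < g t + e].
Proof.
move=> mf mg; apply: D11_ext (D11_bigcup (A := fun q : rat =>
  [set t | f t < ratr q] `&` ~` [set t | g t < ratr q - e]) _).
  move=> t; split=> [[q [/= fq /negP gq]]|].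
    by apply: (lt_le_trans fq); rewrite -leNgt lerBlDr in gq.
  move=> /rat_in_itvoo[q]; rewrite in_itv/= => /andP[fq qg]; exists q; split=> //=.
  by apply/negP; rewrite -leNgt lerBlDr ltW.
by move=> q; apply: D11_setI; [exact: mf|apply: D11_C; exact: mg].
Qed.

Lemma D11_dist_lt (f g : T -> R) (e : R) : meas f -> meas g ->
  D11 [set t | `|f t - g t| < e].
Proof.
move=> mf mg.
apply: D11_ext (D11_setI (D11_lt_add e mf mg) (D11_lt_add e mg mf)) => t /=.
by rewrite ltr_distl ltrBlDr; split=> [[-> ->]|/andP[-> ->]].
Qed.

Lemma D11_eventually (P : nat -> set T) : (forall n, D11 (P n)) ->
  D11 [set t | exists N, forall n, (N <= n)%N -> P n t].
Proof.
move=> DP; apply: D11_bigcup => N.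
apply: D11_ext (D11_bigcap (A := fun n t => (N <= n)%N -> P n t) _).
  by move=> t.
move=> n; case: (leqP N n) => _.
  by apply: D11_ext (DP n) => t; split=> [?|]; [|exact].
by apply: D11_near => t; apply: nearW => s.
Qed.

Lemma D11_lim (a : nat -> T -> R) (b : T -> R) :
  (forall n, meas (a n)) -> meas b -> D11 [set t | a ^~ t @ \oo --> b t].
Proof.
move=> ma mb; apply: D11_ext (D11_bigcap (A := fun j => [set t | exists N,
  forall n, (N <= n)%N -> `|b t - a n t| < j.+1%:R^-1]) _).
  move=> t; split=> [abt|/cvgrPdist_lt abt j]; last first.
    have [|N _ Nn] := abt j.+1%:R^-1; first by rewrite invr_gt0 ltr0n.
    by exists N.
  apply/cvgrPdist_lt => e e0.
  have [j] := ltr_add_invr e0; rewrite add0r => je.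
  have [N Nn] := abt j; exists N => // n /= /Nn /lt_trans; exact.
by move=> j; apply: D11_eventually => n; exact: D11_dist_lt.
Qed.

(** The Cauchy criterion, centred at a term [a M t], replaces the quantifier over the real limit by
    countable ones. *)
Lemma D11_cvg (a : nat -> T -> R) : (forall n, meas (a n)) ->
  D11 [set t | exists r : R, a ^~ t @ \oo --> r].
Proof.
move=> ma; apply: D11_ext (D11_bigcap (A := fun j => [set t | exists M, exists N,
  forall n, (N <= n)%N -> `|a M t - a n t| < j.+1%:R^-1]) _).
  move=> t; split=> [abt|[r /cvgrPdist_lt ar] j]; last first.
    have [|N _ Nn] := ar (j.+1%:R^-1 / 2); first by rewrite divr_gt0 ?invr_gt0 ?ltr0n.
    exists N, N => n nN.
    rewrite (splitr j.+1%:R^-1) (le_lt_trans (ler_distD r _ _))// ltrD//.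
      by rewrite distrC Nn /=.
    exact: Nn.
  suff : cvgn (a ^~ t) by move=> /cvg_ex[r]; exists r.
  apply: (@cauchy_cvg R^o); apply: cauchy_exP => e e0.
  have [j] := ltr_add_invr e0; rewrite add0r => je.
  have [M [N Nn]] := abt j; exists (a M t); exists N => // n /= /Nn.
  by rewrite -ball_normE /=; move/lt_trans; exact.
move=> j; apply: D11_bigcup => M.
by apply: D11_eventually => n; exact: D11_dist_lt.
Qed.

End Measurable.

End Classes.

Section Preimage.
Variables (T U : topologicalType) (g : T -> U).
Hypothesis gc : continuous g.

Lemma S11_preimage (A : set U) : S11 A -> S11 (g @^-1` A).
Proof.
move=> [F [cF AF]]; exists ((fun p : T * baire => (g p.1, p.2)) @^-1` F).
split=> [|t]; last exact: AF.
apply: preimage_closed => // x _; move: x.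
apply: continuous_pair; last exact: continuous_snd.
exact: (@continuous_comp_fun _ T U _ _ (@continuous_fst _ _) gc).
Qed.

Lemma D11_preimage (A : set U) : D11 A -> D11 (g @^-1` A).
Proof. by case=> SA SAC; split; [|rewrite preimage_setC]; exact: S11_preimage. Qed.

End Preimage.

Lemma S11_proj (T : topologicalType) (A : set (T * baire)) :
  S11 A -> S11 [set t | exists x, A (t, x)].
Proof.
move=> [F [cF AF]].
exists ((fun p : T * baire =>
  ((p.1, slice 0 p.2 : baire), slice 1 p.2 : baire)) @^-1` F); split=> [|t].
  apply: preimage_closed => // x _; move: x.
  apply: continuous_pair; last exact: continuous_slice_snd.
  by apply: continuous_pair; [exact: continuous_fst|exact: continuous_slice_snd].
split=> [[x /AF[y Fy]]|[y Fy]]; last by exists (slice 0 y); apply/AF; exists (slice 1 y).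
exists (unslice 0%N (fun i => if i is 0%N then x else y)) => /=.
by rewrite !unsliceK.
Qed.

(** [analytic] asks for an image of the whole Baire space, so closed sets of witnesses must be
    filled out. A point outside [F] goes to a chosen extension in [F] of its longest initial segment
    that has one. *)
Lemma closed_retract (F : set baire) : closed F -> F !=set0 ->
  exists r : baire -> baire,
    [/\ continuous r, forall y, F (r y) & forall y, F y -> r y = y].
Proof.
move=> cF [y0 Fy0].
pose live y n := exists2 x : baire, agree n y x & F x.
have /choice[e eP] : forall p : baire * nat, exists x : baire,
    F x /\ (live p.1 p.2 -> agree p.2 p.1 x).
  move=> [y n]; have [[x yx Fx]|nl] := pselect (live y n); first by exists x.
  by exists y0; split=> // /nl.
(* [e] is applied to zero-padded initial segments, so that off [F] the retraction depends on
   finitely many entries only. *)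
pose rd n (y : baire) : baire := fun i => if (i < n)%N then y i else 0%N.
have rd_agree n (y z : baire) : agree n y z -> rd n y = rd n z.
  by move=> yz; apply/funext => i; rewrite /rd; case: ifP => // /yz.
have rdP n y : agree n y (rd n y) by move=> i ni; rewrite /rd ni.
have live_agree n (y z : baire) : agree n y z -> live y n -> live z n.
  by move=> yz [x yx Fx]; exists x => // i ni; rewrite -yz ?yx.
have liveW m n (y : baire) : (m <= n)%N -> live y n -> live y m.
  by move=> mn [x yx Fx]; exists x => // i im; apply: yx; exact: leq_trans mn.
have ndead y : ~ F y -> exists n, ~ live y n.
  by move=> nF; apply/existsNP => H; apply: nF; apply: ((@closed_agreeP nat F).1 cF).
pose dead y n := `[< ~ live y n >].
have dP y : ~ F y -> exists n, dead y n.
  by move=> /ndead[n dn]; exists n; apply/asboolP.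
(* The least dead length is positive because [F] is nonempty; its predecessor is the longest live
   length. *)
pose r y := if pselect (F y) is right nF then
  e (rd (ex_minn (dP y nF)).-1 y, (ex_minn (dP y nF)).-1) else y.
have rF y : F (r y) by rewrite /r; case: pselect => // nF; exact: (eP _).1.
have r_id y : F y -> r y = y by rewrite /r; case: pselect.
have live0 y : live y 0 by exists y0.
have r_live y n : live y n -> agree n y (r y).
  rewrite /r; case: pselect => // nF; case: ex_minnP => -[|k] /asboolP dk kmin yn.
    by case: dk.
  have nk : (n <= k)%N.
    by rewrite leqNgt; apply/negP => /liveW/(_ yn).
  have lk : live y k.
    by apply: contrapT => dk'; have := kmin k (asboolT dk'); rewrite ltnn.
  move=> i ni; have ik := leq_trans ni nk.
  have ek : agree k (rd k y) (e (rd k y, k)).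
    by apply: (eP (rd k y, k)).2; exact: live_agree (rdP k y) lk.
  by rewrite /= -(ek i ik) -(rdP k y i ik).
exists r; split=> //; apply: (@continuous_seqspace nat) => i y.
have [Fy|nF] := pselect (F y).
  rewrite r_id//; apply: filterS (near_agree (D := nat) y i.+1) => z yz.
  rewrite -(r_live z i.+1)//; first by rewrite -yz.
  by exists y => // j ji; rewrite yz.
have r_dead z k : ~ live z k -> (forall l, ~ live z l -> (k <= l)%N) ->
    r z = e (rd k.-1 z, k.-1).
  move=> dk kmin; rewrite /r; case: pselect => [Fz|nFz]; first by case: dk; exists z.
  case: ex_minnP => l /asboolP dl lmin.
  suff -> : l = k by [].
  by apply/eqP; rewrite eqn_leq kmin// lmin//; apply/asboolP.
have [k dk kmin] : exists2 k, ~ live y k & forall l, ~ live y l -> (k <= l)%N.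
  case: (ex_minnP (dP y nF)) => k /asboolP dk kmin; exists k => // l dl.
  by apply: kmin; apply/asboolP.
apply: filterS (near_agree (D := nat) y k) => z yz.
have zy : agree k z y by move=> j jk; rewrite yz.
rewrite (r_dead z k) ?(r_dead y k)//.
- by rewrite (rd_agree _ y z)// => j jk; apply: yz; exact: (leq_trans jk (leq_pred _)).
- by move/(live_agree _ _ _ zy).
- move=> l dl; rewrite leqNgt; apply/negP => lk.
  have := kmin l; rewrite leqNgt lk => H; apply: dl.
  apply: (live_agree _ y); first by move=> j jl; rewrite yz// (ltn_trans jl).
  by apply: contrapT => /H.
Qed.

Lemma S11_analytic (T : topologicalType) (p : baire -> T) (A : set T) :
  continuous p -> range p = setT -> S11 A -> analytic A.
Proof.
move=> pc pT [F [cF AF]].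
pose G : set baire := (fun y : baire => (p (slice 0 y), slice 1 y : baire)) @^-1` F.
have cG : closed G.
  apply: preimage_closed => // x _; move: x.
  apply: continuous_pair; last exact: continuous_slice.
  exact: (@continuous_comp_fun _ baire T _ _ (@continuous_slice 0) pc).
have GA y : G y -> A (p (slice 0 y)) by move=> Gy; apply/AF; exists (slice 1 y).
have AG t : A t -> exists2 y, G y & p (slice 0 y) = t.
  move=> /AF[y Fy]; have [x _ xt] : range p t by rewrite pT.
  exists (unslice 0%N (fun i => if i is 0%N then x else y)).
    by rewrite /G /= !unsliceK xt.
  by rewrite unsliceK.
have [G0|/set0P/negP/negPn/eqP G0] := pselect (G !=set0); last first.
  by left; apply/seteqP; split=> // t /AG[y]; rewrite G0.
have [r [rc rG r_id]] := closed_retract cG G0; right.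
exists (fun y => p (slice 0 (r y))); split.
  apply: (@continuous_comp_fun _ baire T (fun y => slice 0 (r y)) _ _ pc).
  exact: (@continuous_comp_fun _ baire baire _ _ rc (@continuous_slice 0)).
apply/seteqP; split=> [_ [y _ <-]|t /AG[y Gy <-]]; first exact: GA.
by exists y => //; rewrite r_id.
Qed.

(** * Compact sets given by martingales *)

Lemma branch_exists (b : seq bool -> bool) (u : seq bool) :
  exists2 z : cantor_space, cyl u z &
    forall n, (size u <= n)%N -> z n = b (Defs.prefix z n).
Proof.
pose v n := iter n (fun v => rcons v (b v)) u.
have sv n : size (v n) = (size u + n)%N.
  by elim: n => [|n IH] /=; rewrite ?addn0// size_rcons IH addnS.
have vS m n i : (i < size u + m)%N -> (m <= n)%N ->
    nth false (v n) i = nth false (v m) i.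
  move=> im mn; elim: n mn => [|n IH]; first by rewrite leqn0 => /eqP ->.
  rewrite leq_eqVlt => /predU1P[->//|]; rewrite ltnS => mn /=.
  by rewrite nth_rcons sv (leq_trans im) ?leq_add2l// IH.
pose z : cantor_space := fun i => nth false (v i.+1) i.
have vz n : Defs.prefix z (size u + n) = v n.
  apply: (@eq_from_nth _ false) => [|i]; rewrite size_mkseq ?sv// => i_n.
  rewrite nth_mkseq// /z; case: (leqP n i.+1) => ni; first by rewrite (vS n).
  by rewrite -(vS i.+1 n) ?(ltnW ni)// addnS ltnS leq_addl.
exists z => [|n /subnKC <-]; first by apply/cylP; have := vz 0%N; rewrite addn0.
have := vz (n - size u).+1; rewrite addnS prefixS vz /=.
by move=> /eqP; rewrite eqseq_rcons => /andP[_ /eqP].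
Qed.

Definition body (P : pred (seq bool)) : set cantor_space :=
  [set z | forall n, P (Defs.prefix z n)].

Lemma compact_body (P : pred (seq bool)) : compact (body P).
Proof.
apply: (subclosed_compact _ cantor_space_compact) => //.
apply/(@closed_agreeP bool) => z zK n.
by have [y /agree_prefix -> yK] := zK n; exact: yK.
Qed.

Lemma hits_body (P : pred (seq bool)) (u : seq bool) :
  (forall v b, P (rcons v b) -> P v) ->
  (forall v, P v -> P (rcons v false) || P (rcons v true)) ->
  hits (body P) u = P u.
Proof.
move=> Pr Ps; apply/hitsP/idP => [[z zP /cylP <-]|Pu]; first exact: zP.
have [z uz zE] := branch_exists (fun v => P (rcons v true)) u.
exists z => // n.
have Pz k : P (Defs.prefix z (size u + k)).
  elim: k => [|k IH]; first by rewrite addn0; move/cylP : uz => ->.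
  rewrite addnS prefixS zE ?leq_addr//.
  move: (Ps _ IH); set v := Defs.prefix z _.
  by case E : (P (rcons v true)); rewrite ?E ?orbF.
elim: (size u) (Pz n) => [//|k IH]; rewrite addSn prefixS => /Pr; exact: IH.
Qed.

Section MartingaleSet.
Variables (R : realType) (d : seq bool -> R).
Hypothesis d01 : forall u, 0 <= d u <= 1.
Hypothesis dE : forall u, d u = (d (rcons u false) + d (rcons u true)) / 2.

(** Only the nodes of prescribed density 0 are cut off; that the densities come out as [d] is a
    matter of [rdens_martingale_set]. *)
Definition martingale_set : set cantor_space := body (fun u => d u != 0).
Local Notation K := martingale_set.

Lemma compact_martingale_set : compact K.
Proof. exact: compact_body. Qed.

Lemma martingale_rcons0 u b : d u = 0 -> d (rcons u b) = 0.
Proof.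
move=> du0; have := dE u; rewrite du0.
have := d01 (rcons u false); have := d01 (rcons u true).
by case: b; lra.
Qed.

Lemma martingale_rcons1 u b : d u = 1 -> d (rcons u b) = 1.
Proof.
move=> du0; have := dE u; rewrite du0.
have := d01 (rcons u false); have := d01 (rcons u true).
by case: b; lra.
Qed.

Lemma hits_martingale_set u : hits K u = (d u != 0).
Proof.
apply: (hits_body (P := fun u => d u != 0)) => [v b|v].
  by apply: contraNN => /eqP /martingale_rcons0 ->.
rewrite [in d v]dE; case: (eqVneq (d (rcons v true)) 0) => [->|_]; last by rewrite orbT.
by rewrite addr0 orbF; apply: contraNN => /eqP ->; rewrite mul0r.
Qed.

Lemma martingale_up : exists2 z : cantor_space, d [::] <= d (Defs.prefix z 0) &
  nondecreasing_seq (fun n => d (Defs.prefix z n)).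
Proof.
have [z _ zE] := branch_exists (fun v => d (rcons v false) <= d (rcons v true)) [::].
exists z => //; apply/nondecreasing_seqP => n.
rewrite prefixS zE//; set v := Defs.prefix z n; have := dE v.
by case: (leP (d (rcons v false)) (d (rcons v true))) => h; lra.
Qed.

Lemma le_rcnt_martingale u m : d u <= rcnt R K u m.
Proof.
elim: m u => [|m IH] u.
  rewrite /rcnt expr0 divr1 /= hits_martingale_set.
  by case: eqVneq => [->//|_]; have /andP[] := d01 u.
by rewrite rcntS dE ler_pM2r// lerD.
Qed.

Lemma rcnt_martingale01 u m : d u = 0 \/ d u = 1 -> rcnt R K u m = d u.
Proof.
elim: m u => [|m IH] u du.
  by rewrite /rcnt expr0 divr1 /= hits_martingale_set; case: du => ->;
    rewrite ?eqxx ?oner_eq0.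
by rewrite rcntS dE !IH//; case: du => du;
  by [left; exact: martingale_rcons0|right; exact: martingale_rcons1].
Qed.

(* [N] bounds the distance from any node to a node where [K] is already decided; a fixed proportion of the undecided mass thus disappears every [N] levels. *)
Lemma rdens_martingale_set (N : nat) :
  (forall u, exists2 v, size v = N & d (u ++ v) = 0 \/ d (u ++ v) = 1) ->
  forall u, rdens R K u = d u.
Proof.
move=> dN.
(* A uniform bound on the excess of the counts over [d]. [BN] shrinks it by the factor 1 - 2^-N,
   since at least one of the 2^N descendants of a node has no excess. *)
pose B (c : R) m := forall u, rcnt R K u m - d u <= c.
have BS (c : R) m : B c m -> B c m.+1.
  move=> Bc u; rewrite rcntS [d u]dE.
  by have := Bc (rcons u false); have := Bc (rcons u true); lra.
have BN (c : R) m : 0 <= c -> B c m -> B (c * (1 - 2 ^- N)) (N + m)%N.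
  move=> c0 Bc u; have [v <-] := dN u.
  elim: v u => [|b v IH] u.
    rewrite cats0 => du; rewrite rcnt_martingale01//=.
    by rewrite expr0 invr1 !subrr mulr0.
  rewrite -cat_rcons => /IH {}IH.
  rewrite /= addSn rcntS [d u]dE exprS invfM.
  have Bv : B c (size v + m)%N by elim: (size v) => // k; exact: BS.
  have aux (x y x' y' p : R) : x - x' <= c * (1 - p) -> y - y' <= c ->
      (x + y) / 2 - (x' + y') / 2 <= c * (1 - 2^-1 * p).
    by rewrite !mulrBr !mulr1 mulrCA; move: (c * p) => t; lra.
  have := Bv (rcons u (~~ b)); case: b IH => /= IH h; last first.
    exact: aux.
  by rewrite (addrC (rcnt _ _ _ _)) (addrC (d _)); exact: aux.
set q : R := 1 - 2 ^- N.
have q01 : 0 <= q < 1.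
  rewrite /q gtrBl invr_gt0 exprn_gt0// andbT subr_ge0 invf_le1 ?exprn_gt0//.
  by rewrite exprn_ege1// ler1n.
have Bj j : B (q ^+ j) (N * j)%N.
  elim: j => [|j IH].
    rewrite muln0 expr0 => u; have := rcnt_le R K u 0; have /andP[] := d01 u.
    by case: hits => /=; lra.
  by rewrite mulnS exprSr; apply: BN => //; rewrite exprn_ge0//; case/andP: q01.
move=> u; have cK := compact_martingale_set.
apply/eqP; rewrite eq_le; apply/andP; split; last first.
  rewrite leNgt; apply/negP => /(rdens_lt cK)[m].
  by rewrite ltNge le_rcnt_martingale.
apply/ler_addgt0Pr => e e0.
have : q ^+ j @[j --> \oo] --> (0 : R).
  by apply: cvg_expr; rewrite ger0_norm; case/andP: q01.
move=> /cvgrPdist_lt/(_ e e0)[j _ /(_ j (leqnn j))] /=.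
rewrite sub0r normrN => /(le_lt_trans (ler_norm _)) qe.
rewrite leNgt; apply/negP => due.
have := Bj j u; rewrite lerBlDl => rj.
have : rdens R K u <= rcnt R K u (N * j).
  rewrite leNgt; apply/negP => h.
  have : rdens R K u < rdens R K u by apply/(rdens_lt cK); exists (N * j)%N.
  by rewrite ltxx.
by move: rj qe due; move: (q ^+ j) => p; lra.
Qed.

End MartingaleSet.

(** * The density-controlled compact sets *)

Lemma cvg_subseq (R : realType) (u : nat -> R) (l : R) (g : nat -> nat) :
  (forall N, exists M, forall n, (M <= n)%N -> (N <= g n)%N) ->
  u @ \oo --> l -> u \o g @ \oo --> l.
Proof.
move=> gN ul; apply: cvg_comp ul => A [N _ NA].
have [M MN] := gN N; exists M => // n /= Mn.
by apply: NA => /=; exact: MN.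
Qed.

(** * Steering a density towards a moving target *)

Section Clamp.
Variable R : realType.
Implicit Types x t L : R.

(** If a node has density [x] and a child [x'], the sibling has 2x - x', which lies in [0, 1]
    exactly if [x'] is in [2x - 1, 2x]; [clamp x t] is the point of this interval closest to [t]. *)
Definition clamp x t : R := Num.max (2 * x - 1) (Num.min (2 * x) t).

Variant clamp_spec x t : R -> Type :=
  | ClampHigh of 2 * x <= t : clamp_spec x t (2 * x)
  | ClampLow of t <= 2 * x - 1 : clamp_spec x t (2 * x - 1)
  | ClampId of 2 * x - 1 <= t & t <= 2 * x : clamp_spec x t t.

Lemma clampP x t : clamp_spec x t (clamp x t).
Proof.
rewrite /clamp; case: (leP (2 * x) t) => h.
  by case: (leP (2 * x - 1) (2 * x)) => h'; constructor => //; lra.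
by case: (leP (2 * x - 1) t) => h'; constructor => //; exact: ltW.
Qed.

Lemma clamp_itv x t : 0 < x < 1 -> 0 < t < 1 ->
  [/\ 0 < clamp x t < 1, 2 * x - 1 <= clamp x t & clamp x t <= 2 * x].
Proof.
by move=> /andP[x0 x1] /andP[t0 t1]; case: clampP => *; split; try apply/andP; try split; lra.
Qed.

Lemma clamp_id x t : 2 * x - 1 <= t -> t <= 2 * x -> clamp x t = t.
Proof. by case: clampP => //; lra. Qed.

Lemma clamp_mirror x t : clamp (1 - x) (1 - t) = 1 - clamp x t.
Proof. by case: (clampP x t) => h; case: clampP => h'; lra. Qed.

(** As long as [x] stays at least [e] below [L], every step doubles it, which cannot go on below
    1. *)
Lemma clamp_low (x t : nat -> R) (L e : R) :
  (forall m, 0 < x m < 1) -> (forall m, x m.+1 = clamp (x m) (t m)) ->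
  (forall m, `|t m - L| < e) -> x 0%N <= L - e ->
  exists m, `|x m - L| < e.
Proof.
move=> x01 xS tL x0; apply: contrapT => /forallNP nx.
have H m : x m <= L - e /\ x m.+1 = 2 * x m.
  suff step k : x k <= L - e -> x k.+1 <= L - e /\ x k.+1 = 2 * x k.
    by elim: m => [|m [/step[? ?] _]]; [have [] := step _ x0|have [] := step m.+1].
  move=> xk; have := nx k.+1; have := tL k; have := x01 k.
  rewrite !ltr_distl xS => /andP[? ?] /andP[? ?].
  by case: clampP => *; (split; first rewrite leNgt; first (apply/negP => ?)); lra.
have xE m : x m = 2 ^+ m * x 0%N.
  by elim: m => [|m IH]; rewrite ?expr0 ?mul1r// (H m).2 IH exprS mulrA.
have x00 : 0 < x 0%N by case/andP: (x01 0%N).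
pose m := Num.bound (x 0%N)^-1.
have : 1 <= x m.
  rewrite xE -ler_pdivrMr// div1r.
  have := archi_boundP (ltW (_ : 0 < (x 0%N)^-1)); rewrite invr_gt0 => /(_ x00).
  move=> /ltW/le_trans; apply.
  by rewrite -natrX ler_nat ltnW// ltn_expl.
by have /andP[_] := x01 m; rewrite ltNge => /negP.
Qed.

Lemma clamp_cvg (x t : nat -> R) L : (forall m, 0 < x m < 1) ->
  (forall m, x m.+1 = clamp (x m) (t m)) -> 0 < L < 1 ->
  t @ \oo --> L -> x @ \oo --> L.
Proof.
move=> x01 xS L01 tL.
(* With 3e at most [L] and 1 - L, any [x] and [t] within [e] of [L] satisfy 2x - 1 <= t <= 2x. Once
   [x] has entered this neighbourhood the clamp is inactive and [x] copies [t] with delay one. *)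
pose e := Num.min L (1 - L) / 3.
have e0 : 0 < e by rewrite divr_gt0// lt_min; lra.
have eL : 3 * e <= L /\ 3 * e <= 1 - L.
  by rewrite /e mulrC divfK//; split; rewrite ge_min lexx ?orbT.
have /cvgrPdist_lt/(_ e e0)[M _ Mt] := tL.
have Mt' m : `|t (M + m)%N - L| < e by rewrite distrC Mt//= leq_addr.
have [m0 xm0] : exists m, `|x (M + m)%N - L| < e.
  have [|lo] := leP (x M) (L - e).
    move=> lo; apply: (@clamp_low (fun m => x (M + m)%N) (fun m => t (M + m)%N)) => //.
    - by move=> m; rewrite addnS xS.
    - by rewrite addn0.
  have [|hi] := leP (L + e) (x M); last first.
    by exists 0%N; rewrite addn0 ltr_distl lo hi.
  (* Complementing all densities reduces the approach from above to the one from below. *)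
  move=> hi; have [] := @clamp_low (fun m => 1 - x (M + m)%N)
    (fun m => 1 - t (M + m)%N) (1 - L) e.
  - by move=> m; have := x01 (M + m)%N; lra.
  - by move=> m; rewrite clamp_mirror addnS xS.
  - move=> m; have := Mt' m; rewrite !ltr_distl; lra.
  - by rewrite addn0; lra.
  - by move=> m; exists m; move: p; rewrite !ltr_distl; lra.
have stay m : (M + m0 <= m)%N -> `|x m - L| < e /\ x m.+1 = t m.
  suff stay1 k : (M <= k)%N -> `|x k - L| < e -> x k.+1 = t k.
    move=> /subnKC <-; elim: (m - _)%N => [|j [IH1 IH2]].
      by rewrite addn0; split=> //; apply: stay1 => //; exact: leq_addr.
    have Mj : (M <= M + m0 + j)%N by rewrite -addnA leq_addr.
    have xj : `|x (M + m0 + j).+1 - L| < e.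
      by rewrite IH2 distrC Mt.
    by rewrite addnS; split=> //; apply: stay1 => //; exact: leqW.
  move=> Mk; have := Mt k Mk; rewrite distrC !ltr_distl xS => tk xk.
  apply: clamp_id; lra.
apply/cvgrPdist_lt => d d0.
have /cvgrPdist_lt/(_ d d0)[N _ Nt] := tL.
exists (M + m0 + N).+1 => // -[//|m] /=; rewrite ltnS => Nm.
rewrite (stay _ (leq_trans (leq_addr _ _) Nm)).2 Nt//=.
by rewrite (leq_trans _ Nm)// leq_addl.
Qed.

End Clamp.

Section Machine.
Variable R : realType.
Variable phi : baire -> R.
Hypothesis phi01 : forall y, 0 < phi y < 1.
Hypothesis phi_cont : continuous phi.

Definition extend (s : seq nat) : baire := fun i => nth 0%N s i.

(** The numerator is below both [phi] and 1 - phi, which keeps the targets in (0, 1); the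
    denominator sends the amplitude to 0 as the segment grows. *)
Definition wobble (s : seq nat) : R :=
  phi (extend s) * (1 - phi (extend s)) / (size s).+2%:R.

(* The wobble makes the densities along a branch that stays in [s] forever oscillate, and it disappears along the branches where [s] grows. *)
Definition target (p : seq nat * nat) : R :=
  phi (extend p.1) + (-1) ^+ p.2 * wobble p.1.

Lemma wobble_gt0 s : 0 < wobble s.
Proof.
have /andP[? ?] := phi01 (extend s).
by rewrite divr_gt0// mulr_gt0// subr_gt0.
Qed.

Lemma wobble_le s : wobble s <= phi (extend s) * (1 - phi (extend s)) / 2.
Proof.
have /andP[? ?] := phi01 (extend s).
rewrite ler_pM2l ?mulr_gt0 ?subr_gt0// lef_pV2 ?posrE//.
by rewrite ler_nat.
Qed.

Lemma target01 p : 0 < target p < 1.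
Proof.
rewrite /target; have := wobble_gt0 p.1; have := wobble_le p.1.
move: (wobble _) (phi01 (extend p.1)) => e; move: (phi _) => a /andP[a0 a1] ea e0.
have a0' : 0 < a * (1 - a) by rewrite mulr_gt0// subr_gt0.
have a2 : 0 < a * a by rewrite mulr_gt0.
have a3 : 0 < (1 - a) * (1 - a) by rewrite mulr_gt0 ?subr_gt0.
rewrite -signr_odd; case: odd; rewrite ?expr0 ?expr1 ?mulN1r ?mul1r.
  by apply/andP; split; move: ea a0' a2 a3; rewrite !mulrBr !mulrBl !mulr1 !mul1r; lra.
by apply/andP; split; move: ea a0' a2 a3; rewrite !mulrBr !mulrBl !mulr1 !mul1r; lra.
Qed.

(* The points of the set constructed below are read bit by bit. In a trunk state, [(s, k)] records that the bits 0^s_0 1 0^s_1 1 ... 1 0^k have been read: [Tr] reads the next such bit without changing the density [x], and [Mid] moves the density as far as possible towards the target on the child 1, the child 0 receiving an [Off] part of compensating density. Each [Off d] part is a lexicographic final segment, where the only density values are 0 and 1. *)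
Inductive state := Start | Off of R | Tr of seq nat * nat & R | Mid of seq nat * nat & R.

Definition dens (st : state) : R :=
  match st with Start => 2^-1 | Off d => d | Tr _ x => x | Mid _ x => x end.

Definition off_step (d : R) (b : bool) : R :=
  if d <= 2^-1 then (if b then 2 * d else 0) else (if b then 1 else 2 * d - 1).

Definition code_step (p : seq nat * nat) (b : bool) : seq nat * nat :=
  if b then (rcons p.1 p.2, 0%N) else (p.1, p.2.+1).

(** The child 0 of the root is a half-full [Off] part, so that 0 and 1 are attained whatever [live]
    is. *)
Definition step (live : seq nat -> bool) (st : state) (b : bool) : state :=
  match st with
  | Start => if b then Tr ([::], 0%N) 2^-1 else Off 2^-1
  | Off d => Off (off_step d b)
  | Tr p x => Mid (code_step p b) x
  | Mid p x =>
      let x' := clamp x (target p) in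
      if b then (if live p.1 then Tr p x' else Off x') else Off (2 * x - x')
  end.

Definition valid (st : state) : bool :=
  match st with
  | Start => true
  | Off d => 0 <= d <= 1
  | Tr _ x => 0 < x < 1
  | Mid _ x => 0 < x < 1
  end.

Section Live.
Variable live : seq nat -> bool.

Definition run (u : seq bool) : state := foldl (step live) Start u.
Definition tree_dens (u : seq bool) : R := dens (run u).

Lemma run_rcons u b : run (rcons u b) = step live (run u) b.
Proof. by rewrite /run -cats1 foldl_cat. Qed.

Lemma valid_step st b : valid st -> valid (step live st b).
Proof.
case: st => [|d|p x|p x] /=.
- by case: b => /= _; lra.
- by move=> /andP[d0 d1]; rewrite /off_step; case: (leP _ 2^-1); case: b => h; apply/andP; split; lra.
- by [].
- move=> x01; have [] := clamp_itv x01 (target01 p).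
  move=> /andP[? ?] ? ?.
  by case: b => /=; [case: (live _) => /=|]; apply/andP; split; lra.
Qed.

Lemma valid_run u : valid (run u).
Proof. by elim/last_ind: u => // u b; rewrite run_rcons; exact: valid_step. Qed.

Lemma tree_dens01 u : 0 <= tree_dens u <= 1.
Proof.
rewrite /tree_dens; have := valid_run u.
by case: (run u) => [|d|p x|p x] /=; lra.
Qed.

Lemma tree_densE u :
  tree_dens u = (tree_dens (rcons u false) + tree_dens (rcons u true)) / 2.
Proof.
rewrite /tree_dens !run_rcons; case: (run u) => [|d|p x|p x] /=.
- lra.
- by rewrite /off_step; case: (leP _ 2^-1); lra.
- lra.
- by case: (live _) => /=; lra.
Qed.

Lemma off_step01 d : exists b, off_step d b = 0 \/ off_step d b = 1.
Proof.
rewrite /off_step; case: (leP _ 2^-1) => _; first by exists false; left.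
by exists true; right.
Qed.

(** Three levels are the worst case, met at [Tr]: pass to [Mid], enter an [Off] part, take its child
    of density 0 or 1. Decided parts stay decided, so shorter words are padded. *)
Lemma tree_dens_decided u :
  exists2 v, size v = 3%N & tree_dens (u ++ v) = 0 \/ tree_dens (u ++ v) = 1.
Proof.
suff [v sv [d dE d01]] : exists2 v, (size v <= 3)%N &
    exists2 d, run (u ++ v) = Off d & d = 0 \/ d = 1.
  exists (v ++ nseq (3 - size v) false); first by rewrite size_cat size_nseq subnKC.
  rewrite catA /tree_dens.
  suff -> : run ((u ++ v) ++ nseq (3 - size v) false) = Off d by [].
  rewrite /run foldl_cat -/(run _) dE; elim: (3 - size v)%N => //= n.
  rewrite (_ : off_step d false = d)// /off_step.
  by case: d01 => ->; case: (leP _ 2^-1); lra.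
have offP w d : run (u ++ w) = Off d -> exists b,
    exists2 d', run (u ++ rcons w b) = Off d' & d' = 0 \/ d' = 1.
  move=> wE; have [b db] := off_step01 d; exists b, (off_step d b) => //.
  by rewrite -rcons_cat run_rcons wE.
have midP w p x : run (u ++ w) = Mid p x -> exists d, run (u ++ rcons w false) = Off d.
  by move=> wE; exists (2 * x - clamp x (target p)); rewrite -rcons_cat run_rcons wE.
have runu w : run u = run (u ++ [::]) by rewrite cats0.
case E : (run u) => [|d|p x|p x].
- have [|b [d dE d01]] := offP [:: false] 2^-1.
    by rewrite cats1 run_rcons E.
  by exists [:: false; b] => //; exists d.
- have [|b [d' dE d01]] := offP [::] d; first by rewrite cats0.
  by exists [:: b] => //; exists d'.
- have [|d dE] := midP [:: false] (code_step p false) x.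
    by rewrite cats1 run_rcons E.
  have [b [d' d'E d01]] := offP _ _ dE.
  by exists [:: false; false; b] => //; exists d'.
- have [|d dE] := midP [::] p x; first by rewrite cats0.
  have [b [d' d'E d01]] := offP _ _ dE.
  by exists [:: false; b] => //; exists d'.
Qed.

Definition tree_set : set cantor_space := martingale_set tree_dens.

Lemma compact_tree_set : compact tree_set.
Proof. exact: compact_martingale_set. Qed.

Lemma dens_seq_tree_set (z : cantor_space) (n : nat) :
  dens_seq tree_set z n = tree_dens (Defs.prefix z n).
Proof.
rewrite dens_seqE.
exact: (rdens_martingale_set tree_dens01 tree_densE tree_dens_decided).
Qed.

End Live.
End Machine.

(** * Decoding bit sequences by their runs of zeros *)

Fixpoint code (w : nat -> bool) (m : nat) : seq nat * nat :=
  if m is m'.+1 then code_step (code w m') (w m') else ([::], 0%N).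

Lemma code_catl (w : nat -> bool) (m n : nat) : (m <= n)%N ->
  exists s, (code w n).1 = (code w m).1 ++ s.
Proof.
move=> /subnKC <-; elim: (n - m)%N => [|k [s IH]]; first by exists [::]; rewrite addn0 cats0.
rewrite addnS /=; case: (w _) => /=; last by exists s.
by exists (rcons s (code w (m + k)).2); rewrite IH rcons_cat.
Qed.

Lemma nth_code (w : nat -> bool) (m n i : nat) :
  (i < size (code w m).1)%N -> (i < size (code w n).1)%N ->
  nth 0%N (code w m).1 i = nth 0%N (code w n).1 i.
Proof.
wlog mn : m n / (m <= n)%N => [H im jn|im _].
  by have [/H|/ltnW/H] := leqP m n; [exact|move=> ->].
by have [s ->] := code_catl w mn; rewrite nth_cat im.
Qed.

Lemma size_code (w : nat -> bool) (m : nat) :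
  size (code w m.+1).1 = (w m + size (code w m).1)%N.
Proof. by rewrite /=; case: (w m); rewrite //= size_rcons. Qed.

Lemma size_code_homo (w : nat -> bool) (m n : nat) : (m <= n)%N ->
  (size (code w m).1 <= size (code w n).1)%N.
Proof. by move=> /(code_catl w)[s ->]; rewrite size_cat leq_addr. Qed.

Lemma code_unbounded (w : nat -> bool) : (forall M, exists2 m, (M <= m)%N & w m) ->
  forall n, exists m, (n <= size (code w m).1)%N.
Proof.
move=> wM; elim=> [|n [m nm]]; first by exists 0%N.
have [k mk wk] := wM m; exists k.+1; rewrite size_code wk.
by rewrite ltnS (leq_trans nm)// size_code_homo.
Qed.

Lemma size_code_onto (w : nat -> bool) :
  (forall n, exists m, (n <= size (code w m).1)%N) ->
  forall n, exists m, size (code w m).1 = n.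
Proof.
move=> wn n; case: (ex_minnP (wn n)) => -[|m] nm mmin.
  by exists 0%N; apply/eqP; rewrite eq_sym -leqn0.
exists m.+1; apply/eqP; rewrite eqn_leq nm andbT size_code.
have : (size (code w m).1 < n)%N.
  by rewrite ltnNge; apply/negP => /mmin; rewrite ltnn.
by case: (w m) => /=; lia.
Qed.

Lemma size_code_le (w : nat -> bool) (m : nat) : (size (code w m).1 <= m)%N.
Proof.
by elim: m => // m IH; rewrite size_code; case: (w m) => /=; rewrite ?ltnS// leqW.
Qed.

Lemma code_branch (w : nat -> bool) :
  (forall n, exists m, (n <= size (code w m).1)%N) ->
  exists y : baire, forall m, (code w m).1 = mkseq y (size (code w m).1).
Proof.
move=> wn.
have /choice[M Mn] : forall i, exists m, (i < size (code w m).1)%N.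
  by move=> i; exact: wn.
exists (fun i => nth 0%N (code w (M i)).1 i) => m.
apply: (@eq_from_nth _ 0%N) => [|i im]; first by rewrite size_mkseq.
by rewrite nth_mkseq//; exact: nth_code.
Qed.

Lemma code_exists (y : baire) : exists2 w : nat -> bool,
  forall m, (code w m).1 = mkseq y (size (code w m).1) &
  forall n, exists m, (n <= size (code w m).1)%N.
Proof.
(* A 1 is emitted exactly when the current run of zeros has the length that [y] prescribes next. *)
pose bit (p : seq nat * nat) : bool := p.2 == y (size p.1).
pose p m := iter m (fun p => code_step p (bit p)) ([::], 0%N).
pose w m := bit (p m).
have pE m : code w m = p m by elim: m => //= m ->.
have p_in m : (p m).1 = mkseq y (size (p m).1) /\ ((p m).2 <= y (size (p m).1))%N.
  elim: m => [//|m [IH1 IH2]].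
  rewrite [p m.+1]/(code_step (p m) (bit (p m))) /code_step /bit.
  case: eqVneq => [yE|ne] /=.
    by rewrite size_rcons mkseqS -IH1 yE.
  by split=> //; rewrite ltn_neqAle ne.
exists w => [m|]; first by rewrite pE; have [] := p_in m.
elim=> [|n [m nm]]; first by exists 0%N.
have grow j : (j <= y (size (p m).1) - (p m).2)%N ->
    p (m + j)%N = ((p m).1, ((p m).2 + j)%N).
  elim: j => [|j IH] jy; first by rewrite !addn0 -surjective_pairing.
  rewrite addnS [p _]/(code_step (p (m + j)%N) (bit (p (m + j)%N))) IH; last exact: ltnW.
  rewrite /bit /= ltn_eqF ?addnS// .
  by have [_] := p_in m; lia.
exists (m + (y (size (p m).1) - (p m).2)).+1.
rewrite size_code !pE /w grow// /bit /= subnKC ?eqxx//; last by have [] := p_in m.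
by rewrite ltnS; rewrite pE in nm.
Qed.

(** * The density range of the constructed set *)

Section Range.
Variables (R : realType) (phi : baire -> R).
Hypothesis phi01 : forall y, 0 < phi y < 1.
Hypothesis phi_cont : continuous phi.
Variable live : seq nat -> bool.
Hypothesis live_nil : live [::].

Local Notation K := (tree_set phi live).
Local Notation state_at z n := (run phi live (Defs.prefix z n)).

Lemma ran_densityP (r : R) : ran_density K r <->
  exists z : cantor_space, dens (state_at z n) @[n --> \oo] --> r.
Proof.
split=> -[z zr]; exists z.
  rewrite (_ : (fun n => _) = dens_seq K z)//.
  by apply/funext => n; rewrite (dens_seq_tree_set phi01).
rewrite (_ : dens_seq K z = fun n => dens (state_at z n))//.
by apply/funext => n; rewrite (dens_seq_tree_set phi01).
Qed.

Lemma state_atS (z : cantor_space) (n : nat) :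
  state_at z n.+1 = step phi live (state_at z n) (z n).
Proof. by rewrite prefixS run_rcons. Qed.

Lemma zero_mul_cvg (a b : nat -> R) (r : R) : a @ \oo --> r -> b @ \oo --> r ->
  (forall n, a n * (1 - a n) * (b n * (1 - b n)) = 0) -> r = 0 \/ r = 1.
Proof.
move=> ar br ab0.
have h : (fun n => a n * (1 - a n) * (b n * (1 - b n))) @ \oo -->
    r * (1 - r) * (r * (1 - r)).
  by apply: (@cvgM R); apply: (@cvgM R) => //; apply: (@cvgB _ R^o) => //; exact: cvg_cst.
rewrite (_ : (fun n => _) = fun=> 0) in h; last exact/funext.
have h0 : (fun _ : nat => 0 : R) @ \oo --> (0 : R) by exact: cvg_cst.
have /eqP : r * (1 - r) * (r * (1 - r)) = 0.
  exact: (@norm_cvg_unique _ R^o _ _ _ _ h h0).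
rewrite !mulf_eq0 orbb subr_eq0 => /orP[/eqP|/eqP]; by [left|right].
Qed.

(** Below an [Off] node, one of any two siblings has density 0 or 1. If the densities along [z] tend
    to [r], so do those of the siblings left aside, and [zero_mul_cvg] applies to the pair. *)
Lemma off_limit (z : cantor_space) (r : R) (n : nat) (d : R) :
  state_at z n = Off d -> dens (state_at z n) @[n --> \oo] --> r ->
  r = 0 \/ r = 1.
Proof.
move=> zn zr.
have off k : exists e, state_at z (n + k)%N = Off e.
  elim: k => [|k [e IH]]; first by exists d; rewrite addn0.
  by exists (off_step e (z (n + k)%N)); rewrite addnS state_atS IH.
pose u k := dens (state_at z (n + k)%N).
have uS k : u k.+1 = off_step (u k) (z (n + k)%N).
  by rewrite /u addnS state_atS; have [e ->] := off k.
have ur : u @ \oo --> r.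
  apply: (cvg_subseq (u := fun n => dens (state_at z n)) (g := addn n)) => // N.
  by exists N => k Nk; rewrite (leq_trans Nk)// leq_addl.
have ur' : (fun k => u k.+1) @ \oo --> r by rewrite (cvg_shiftS u).
have vr : (fun k => 2 * u k - u k.+1) @ \oo --> r.
  rewrite (_ : r = 2 * r - r); last by lra.
  apply: (@cvgB _ R^o) => //; exact: cvgMl_tmp.
apply: (zero_mul_cvg ur' vr) => k; rewrite uS /off_step.
by case: (leP _ 2^-1) => _; case: (z _); ring.
Qed.

(** The bits of [w] stand at the odd positions of a trunk branch; the bits at even positions are 1,
    to stay on the trunk. *)
Fixpoint path_dens (w : nat -> bool) (m : nat) : R :=
  if m is m'.+1 then clamp (path_dens w m') (target phi (code w m)) else 2^-1.

Lemma path_dens01 (w : nat -> bool) (m : nat) : 0 < path_dens w m < 1.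
Proof.
elim: m => [|m IH] /=; first by lra.
by have [] := clamp_itv IH (target01 phi01 (code_step (code w m) (w m))).
Qed.

Lemma path_state (z : cantor_space) : (forall n d, state_at z n <> Off d) ->
  forall m, [/\ state_at z m.*2.+1 = Tr (code (fun i => z i.*2.+1) m)
                  (path_dens (fun i => z i.*2.+1) m),
                live (code (fun i => z i.*2.+1) m).1 & z m.*2].
Proof.
move=> nOff; set w := fun i => _.
elim=> [|m [IH _ _]].
  have := nOff 1%N 2^-1; rewrite state_atS.
  by case: (z 0%N).
have E : state_at z m.*2.+2 = Mid (code w m.+1) (path_dens w m).
  by rewrite state_atS IH.
have := nOff m.*2.+3; rewrite doubleS state_atS E /=.
case: (z m.*2.+2) => H; last by have [] := H _ erefl.
by case: ifP H => // _ H; have [] := H _ erefl.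
Qed.

Lemma path_state_inv (w : nat -> bool) (z : cantor_space) :
  (forall m, live (code w m).1) -> (forall i, z i = if odd i then w i./2 else true) ->
  forall n, dens (state_at z n.+1) = path_dens w n./2.
Proof.
move=> lw zE.
have odd_state m : state_at z m.*2.+1 = Tr (code w m) (path_dens w m) /\
    state_at z m.*2.+2 = Mid (code w m.+1) (path_dens w m).
  elim: m => [|m [_ IH]].
    by rewrite !state_atS !zE.
  have E : state_at z m.*2.+3 = Tr (code w m.+1) (path_dens w m.+1).
    by rewrite state_atS IH zE /= negbK odd_double /= (lw m.+1).
  by rewrite doubleS; split=> //; rewrite state_atS E zE /= !negbK odd_double /= uphalf_double.
move=> n; rewrite -{1}(odd_double_half n); case: (odd n) => /=.
  by rewrite add1n (odd_state _).2.
by rewrite add0n (odd_state _).1.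
Qed.

Lemma target_cvg (w : nat -> bool) (y : baire) :
  (forall m, (code w m).1 = mkseq y (size (code w m).1)) ->
  (forall n, exists m, (n <= size (code w m).1)%N) ->
  (fun m => target phi (code w m.+1)) @ \oo --> phi y.
Proof.
move=> wy wn; apply/cvgrPdist_lt => e e0.
have e20 : 0 < e / 2 by rewrite divr_gt0.
have : \forall x \near y, `|phi y - phi x| < e / 2.
  by have /cvgrPdist_lt/(_ _ e20) := @phi_cont y.
move=> /(@nbhs_agreeP nat)[n yn].
have [k] := ltr_add_invr e20; rewrite add0r => ke.
have [M Mn] := wn (maxn n k); exists M => // m /= Mm.
have := leq_trans Mn (leq_trans (size_code_homo w Mm) (size_code_homo w (leqnSn m))).
rewrite -/(code w m.+1); move: (code w m.+1) (wy m.+1) => -[s j] /= sE.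
rewrite geq_max => /andP[ns ks].
rewrite /target /= opprD addrA (le_lt_trans (ler_normB _ _))// (splitr e) ltrD//.
  apply: yn => i i_n; rewrite /extend sE nth_mkseq//.
  exact: leq_trans i_n ns.
rewrite normrM normrX normrN1 expr1n mul1r.
rewrite ger0_norm; last exact/ltW/wobble_gt0.
apply: le_lt_trans ke; rewrite /wobble ler_pdivrMr//.
have /andP[p0 p1] := phi01 (extend s).
apply: (@le_trans _ _ 1).
  by apply: mulr_ile1; lra.
by rewrite ler_pdivlMl// mulr1 ler_nat ltnW// ltnS leqW.
Qed.

(** The segment being frozen, the targets alternate between two values at distance twice the wobble.
    A limit other than 0 and 1 would make the clamp inactive eventually, and the densities would
    alternate as well. *)
Lemma stuck_limit (w : nat -> bool) (M : nat) (r : R) :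
  (forall m, (M <= m)%N -> ~~ w m) -> path_dens w @ \oo --> r ->
  r = 0 \/ r = 1.
Proof.
move=> wM xr.
pose s := (code w M).1; pose k := (code w M).2.
have cE m : code w (M + m)%N = (s, (k + m)%N).
  elim: m => [|m IH]; first by rewrite !addn0 -surjective_pairing.
  by rewrite addnS /= IH (negbTE (wM _ (leq_addr _ _))) /code_step /= addnS.
pose x m := path_dens w (M + m)%N.
have xr0 : x @ \oo --> r.
  apply: (cvg_subseq (u := path_dens w) (g := addn M)) => // N.
  by exists N => n Nn; rewrite (leq_trans Nn)// leq_addl.
have xr1 : (fun m => x m.+1) @ \oo --> r by rewrite (cvg_shiftS x).
have vr : (fun m => 2 * x m - x m.+1) @ \oo --> r.
  rewrite (_ : r = 2 * r - r); last by lra.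
  apply: (@cvgB _ R^o) => //; exact: cvgMl_tmp.
have [->|r0] := eqVneq r 0; first by left.
have [->|r1] := eqVneq r 1; first by right.
pose e := wobble phi s; have e0 : 0 < e := wobble_gt0 phi01 s.
have min0 : 0 < Num.min (Num.min `|r| `|1 - r|) e.
  by rewrite !lt_min !normr_gt0 r0 subr_eq0 eq_sym r1.
have /cvgrPdist_lt/(_ _ min0)[N1 _ N1P] := vr.
have /cvgrPdist_lt/(_ _ e0)[N2 _ N2P] := xr1.
(* An active clamp makes the sibling density [2 * x m - x m.+1] equal to 0 or 1, whereas it tends to
   [r]. *)
have tE m : (N1 <= m)%N -> x m.+1 = target phi (s, (k + m.+1)%N).
  move=> Nm; have := N1P m Nm; rewrite !lt_min => /andP[/andP[v0 v1] _].
  have xS : x m.+1 = clamp (x m) (target phi (s, (k + m.+1)%N)).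
    by rewrite /x addnS /= -/(code w (M + m).+1) -addnS cE.
  move: xS; case: clampP => // _ xE.
    by rewrite xE subrr subr0 ltxx in v0.
  have E1 : 2 * x m - (2 * x m - 1) = 1 by ring.
  by rewrite xE E1 distrC ltxx in v1.
pose N := maxn N1 N2.
have h1 := N2P N (leq_maxr _ _); have h2 := N2P N.+1 (leqW (leq_maxr _ _)).
have : `|x N.+1 - x N.+2| < e + e.
  by rewrite (le_lt_trans (ler_distD r _ _))// ltrD// distrC.
rewrite !tE ?(leqW (leq_maxl _ _)) ?leq_maxl// /target /= -/e.
rewrite !addnS !exprS; set a := phi _; set q := (-1) ^+ _.
have -> : a + -1 * q * e - (a + -1 * (-1 * q) * e) = - (q * (e + e)) by ring.
rewrite normrN normrM normrX normrN1 expr1n mul1r gtr0_norm ?ltxx//.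
exact: addr_gt0.
Qed.

Lemma ran_density_tree_set : ran_density K =
  [set phi y | y in [set y : baire | forall n, live (mkseq y n)]] `|`
  [set r | r = 0 \/ r = 1].
Proof.
apply/seteqP; split=> r.
  move=> /ran_densityP[z zr].
  have [[n [d zn]]|/forallNP nOff] := pselect (exists n d, state_at z n = Off d).
    by right; exact: off_limit zn zr.
  have {}nOff n d : state_at z n <> Off d by move/forallNP : (nOff n); exact.
  have H := path_state nOff; set w := fun i => _ in H.
  have xr : path_dens w @ \oo --> r.
    rewrite (_ : path_dens w = (fun n => dens (state_at z n)) \o (fun m => m.*2.+1)).
      apply: cvg_subseq zr => N; exists N => n Nn.
      by rewrite ltnW// ltnS -addnn (leq_trans Nn)// leq_addr.
    by apply/funext => m /=; have [-> _ _] := H m.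
  have [[M wM]|/forallNP wM] := pselect (exists M, forall m, (M <= m)%N -> ~~ w m).
    by right; exact: stuck_limit wM xr.
  left; have wn : forall n, exists m, (n <= size (code w m).1)%N.
    apply: code_unbounded => M; have /existsNP[m /not_implyP[Mm /negP]] := wM M.
    by rewrite negbK; exists m.
  have [y wy] := code_branch wn; exists y; last first.
    apply/esym/(@norm_cvg_unique _ R^o _ _ _ _ xr).
    apply: (clamp_cvg (t := fun m => target phi (code w m.+1))) => //.
    - exact: path_dens01.
    - exact: target_cvg.
  move=> n; have [m <-] := size_code_onto wn n.
  by rewrite -wy; have [_ lm _] := H m.
case=> [[y ly <-]|r01].
  have [w wy wn] := code_exists y.
  apply/ran_densityP; pose z : cantor_space := fun i => if odd i then w i./2 else true.
  exists z; rewrite -(cvg_shiftS (fun n => dens (state_at z n))).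
  rewrite (_ : (fun n => _) = path_dens w \o half); last first.
    apply/funext => n /=; rewrite (path_state_inv (w := w))// => m.
    by rewrite wy.
  apply: cvg_subseq => [N|]; first by exists N.*2 => n Nn; rewrite -(doubleK N) half_leq.
  apply: (clamp_cvg (t := fun m => target phi (code w m.+1))) => //.
  - exact: path_dens01.
  - exact: target_cvg.
apply/ran_densityP.
have [b rb] : exists b : bool, r = b%:R by case: r01 => ->; [exists false|exists true].
(* The bit 0 at the root enters the half-full part, and the next bit selects its empty or its full
   half. *)
pose z : cantor_space := fun i => (i == 1%N) && b.
exists z; apply/cvgrPdist_lt => e e0; exists 2%N => // -[//|[//|n _]] /=.
suff -> : state_at z n.+2 = Off b%:R by rewrite rb subrr normr0.
elim: n => [|n IH]; rewrite state_atS.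
  by rewrite !state_atS /z /= /off_step lexx; case: b {rb z} => //=; rewrite mulfV.
by rewrite IH /z /= /off_step; case: b {rb IH z} => /=; case: (leP _ 2^-1) => h; congr Off; lra.
Qed.

End Range.

(** The state at a node consults [live] at finitely many segments only, whence continuity in [t]. *)
Lemma density_construction (R : realType) (phi : baire -> R)
  (T : topologicalType) (live : T -> seq nat -> bool) :
  (forall y, 0 < phi y < 1) -> continuous phi -> (forall t, live t [::]) ->
  (forall s t, \forall t' \near t, live t' s = live t s) ->
  exists2 f : T -> Kspace, continuous f & forall t, ran_density (proj1_sig (f t)) =
    [set phi y | y in [set y : baire | forall n, live t (mkseq y n)]] `|`
    [set r | r = 0 \/ r = 1].
Proof.
move=> phi01 phi_cont live_nil live_near.
exists (fun t => exist _ (tree_set phi (live t)) (@compact_tree_set R phi (live t))).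
  apply: continuous_Kspace => u t /=.
  have near_run : \forall t' \near t, run phi (live t') u = run phi (live t) u.
    elim/last_ind: u => [|u b IH]; first exact: nearW.
    pose s := if run phi (live t) u is Mid p _ then p.1 else [::].
    apply: filterS2 IH (live_near s t) => t' IH.
    by rewrite !run_rcons IH /s; case: (run _ _ _) => //= p x ->.
  apply: filterS near_run => t' E.
  by rewrite !hits_martingale_set ?/tree_dens ?E//; try exact: tree_dens01;
    exact: tree_densE.
by move=> t /=; exact: ran_density_tree_set.
Qed.

(** * Upper bounds *)

Definition to_cantor (y : baire) : cantor_space := fun i => y i != 0%N.

Lemma continuous_to_cantor : continuous to_cantor.
Proof.
apply: (@continuous_seqspace bool) => i y.
by apply: filterS (@near_seqspace_coord nat y i) => x xy; rewrite /to_cantor xy.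
Qed.

Lemma to_cantor_surj (z : cantor_space) : exists y, to_cantor y = z.
Proof.
exists (fun i => nat_of_bool (z i)); apply/funext => i.
by rewrite /to_cantor; case: (z i).
Qed.

(** No value excludes both children, so that every sequence codes a tree without leaves and
    [coded_set] is total. *)
Definition allowed (a : nat) (b : bool) : bool :=
  match a with 0%N => ~~ b | 1%N => b | _ => true end.

Definition seq_code (u : seq bool) : nat := choice.pickle u.

(* [y 0 = 0] codes the empty compact set; otherwise the entry of [y] attached to a node tells which of its children belong to the tree of the coded set. *)
Fixpoint coded_tree (y : baire) (v u : seq bool) : bool :=
  if u is b :: u' then allowed (y (seq_code v).+1) b && coded_tree y (rcons v b) u'
  else y 0%N != 0%N.

Lemma coded_tree_rcons y v u b : coded_tree y v (rcons u b) =
  coded_tree y v u && allowed (y (seq_code (v ++ u)).+1) b.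
Proof.
elim: u v => [|c u IH] v /=; first by rewrite cats0 andbC.
by rewrite IH cat_rcons andbA.
Qed.

Definition coded_set (y : baire) : Kspace :=
  exist _ (body (coded_tree y [::])) (@compact_body (coded_tree y [::])).

Lemma hits_coded_set y u : hits (proj1_sig (coded_set y)) u = coded_tree y [::] u.
Proof.
apply: hits_body => [v b|v Pv]; first by rewrite coded_tree_rcons => /andP[].
by rewrite !coded_tree_rcons Pv /=; case: (y _) => [//|[]].
Qed.

Lemma continuous_coded_set : continuous coded_set.
Proof.
apply: continuous_Kspace => u y.
have : \forall x \near y, coded_tree x [::] u = coded_tree y [::] u.
  elim: u [::] => [|b u IH] v /=.
    by apply: filterS (@near_seqspace_coord nat y 0) => x ->.
  apply: filterS2 (IH (rcons v b)) (@near_seqspace_coord nat y (seq_code v).+1).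
  by move=> x -> ->.
by apply: filterS => x; rewrite !hits_coded_set.
Qed.

Lemma compact_bodyE (A : set cantor_space) : compact A -> A = body (hits A).
Proof.
move=> cA; apply/seteqP; split=> z => [Az n|zA].
  by apply/hitsP; exists z => //; rewrite cyl_prefix.
have /(@closed_agreeP bool) : closed A.
  exact: compact_closed cantor_space_hausdorff cA.
by apply => n; have /hitsP[y Ay] := zA n; rewrite cyl_prefix; exists y.
Qed.

Lemma Kspace_eq (K L : Kspace) : proj1_sig K = proj1_sig L -> K = L.
Proof.
case: K L => [K cK] [L cL] /= KL; rewrite -KL in cL *.
by rewrite (Prop_irrelevance cK cL).
Qed.

Lemma coded_set_surj (K : Kspace) : exists y, coded_set y = K.
Proof.
set A := proj1_sig K.
pose node u := if hits A (rcons u true) then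
  (if hits A (rcons u false) then 2%N else 1%N) else 0%N.
pose y : baire := fun i => if i is j.+1 then
  (if choice.unpickle j is Some u then node u else 0%N) else hits A [::].
exists y; apply: Kspace_eq; rewrite /= [RHS](compact_bodyE (proj2_sig K)).
congr body; apply/funext => u; elim/last_ind: u => [|u b IH].
  by rewrite /= -/A; case: (hits A [::]).
have yu : y (seq_code u).+1 = node u by rewrite /y /seq_code choice.pickleK.
rewrite coded_tree_rcons IH cat0s yu -/A /node.
have := hitsE A u; case: b; case: (hits A (rcons u true));
  case: (hits A (rcons u false)) => ->; by [].
Qed.

Lemma Kspace_surj : exists2 p : baire -> Kspace, continuous p & range p = setT.
Proof.
exists coded_set; first exact: continuous_coded_set.
by apply/seteqP; split=> // K _; have [y <-] := coded_set_surj K; exists y.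
Qed.

Lemma Kspace_baire_surj : exists2 p : baire -> Kspace * baire,
  continuous p & range p = setT.
Proof.
exists (fun y => (coded_set (slice 0 y), slice 1 y : baire)).
  apply: continuous_pair; last exact: continuous_slice.
  exact: (@continuous_comp_fun _ baire Kspace _ _ (@continuous_slice 0)
    continuous_coded_set).
apply/seteqP; split=> // -[K x] _; have [y <-] := coded_set_surj K.
exists (unslice 0%N (fun i => if i is 0%N then y else x)) => //.
by rewrite !unsliceK.
Qed.

Lemma countable_range (T : Type) (S : set T) : S !=set0 -> countable S ->
  exists e : nat -> T, range e = S.
Proof.
move=> [s Ss] /pfcard_geP[SE|/unsquash e]; first by rewrite SE in Ss.
by exists e; exact: image_eq.
Qed.

(** * Definability of densities and the three upper bounds *)

Section Complexity.
Variable R : realType.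

Lemma near_rcnt (u : seq bool) (m : nat) (K : Kspace) :
  \forall L \near K, rcnt R (proj1_sig L) u m = rcnt R (proj1_sig K) u m.
Proof.
elim: m u => [|m IH] u.
  by apply: filterS (near_hits u K) => L; rewrite /rcnt /= => ->.
apply: filterS2 (IH (rcons u false)) (IH (rcons u true)) => L.
by rewrite !rcntS => -> ->.
Qed.

Lemma D11_rdens_lt (u : seq bool) (q : R) :
  D11 [set K : Kspace | rdens R (proj1_sig K) u < q].
Proof.
have : D11 [set K : Kspace | exists m, rcnt R (proj1_sig K) u m < q].
  by apply: D11_bigcup => m; apply: D11_near => K;
    apply: filterS (near_rcnt u m K) => L /= ->.
by apply: D11_ext => K /=; rewrite -(rdens_lt (proj2_sig K)).
Qed.

Section Param.
Variables (T : topologicalType) (k : T -> Kspace) (c : T -> baire).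
Hypotheses (kc : continuous k) (cc : continuous c).

Let dseq (t : T) : nat -> R := dens_seq (proj1_sig (k t)) (to_cantor (c t)).

(** The node read at depth [n] is locally constant in [t]; a countable union over its value leaves
    the density at a fixed node. *)
Lemma meas_dens_seq n : meas (fun t => dseq t n).
Proof.
move=> q; apply: D11_ext (D11_bigcup (A := fun u : seq bool =>
  [set t | Defs.prefix (to_cantor (c t)) n = u] `&`
  [set t | rdens R (proj1_sig (k t)) u < q]) _).
  move=> t /=; rewrite /dseq dens_seqE; split=> [[u [<-]]|tq] //.
  by exists (Defs.prefix (to_cantor (c t)) n).
move=> u; apply: D11_setI; last exact: (D11_preimage kc (D11_rdens_lt u q)).
apply: D11_near => t.
have cc' : continuous (fun t => to_cantor (c t)).
  exact: (@continuous_comp_fun _ baire cantor_space _ _ cc continuous_to_cantor).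
have : \forall s \near t, agree n (to_cantor (c t)) (to_cantor (c s)).
  exact: (cc' t _ (@near_agree bool (to_cantor (c t)) n)).
by apply: filterS => s /agree_prefix /= ->.
Qed.

Lemma D11_dens_lim (b : T -> R) : continuous b -> D11 [set t | dseq t @ \oo --> b t].
Proof. by move=> bc; apply: D11_lim; [exact: meas_dens_seq|exact: meas_continuous]. Qed.

Lemma D11_dens_cvg : D11 [set t | exists r : R, dseq t @ \oo --> r].
Proof. by apply: D11_cvg; exact: meas_dens_seq. Qed.

End Param.

Let fstc := @continuous_fst Kspace baire.
Let sndc := @continuous_snd Kspace baire.

Lemma ran_densityE (A : set cantor_space) (r : R) : ran_density A r <->
  exists x : baire, dens_seq A (to_cantor x) @ \oo --> r.
Proof.
split=> [[z zr]|[x xr]]; last by exists (to_cantor x).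
by have [x xz] := to_cantor_surj z; exists x; rewrite xz.
Qed.

Lemma S11_ran_density (c : R) : S11 [set K : Kspace | ran_density (proj1_sig K) c].
Proof.
apply: S11_ext (S11_proj (D11_S11 (D11_dens_lim fstc sndc (b := fun=> c) _))).
  by move=> K; rewrite /= ran_densityE.
by move=> x; exact: cvg_cst.
Qed.

(* The projection of [outlier P], for [P] expressing that the limit lies in [S], consists of the [K] having a density value outside [S]. *)
Definition outlier (P : set (Kspace * baire)) : set (Kspace * baire) :=
  [set t | exists r : R, dens_seq (proj1_sig t.1) (to_cantor t.2) @ \oo --> r] `&` ~` P.

(** By uniqueness of limits, a value escapes [S] exactly when some point has a limit density but
    none in [S]; the quantifier over reals becomes one over points. *)
Lemma outlierP (S : set R) (K : Kspace) :
  ran_density (proj1_sig K) `<=` S <-> ~ exists x, outlier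
    [set t | exists2 r, S r & dens_seq (proj1_sig t.1) (to_cantor t.2) @ \oo --> r] (K, x).
Proof.
split=> [KS [x [[r xr] nS]]|H r].
  by apply: nS; exists r => //; apply: KS; exists (to_cantor x).
move=> /ran_densityE[x xr]; apply: contrapT => nSr; apply: H; exists x; split.
  by exists r.
move=> [r' Sr' xr']; apply: nSr.
by rewrite (@norm_cvg_unique _ R^o _ _ _ _ xr xr').
Qed.

Lemma D11_countable_lim (e : nat -> R) : D11 [set t : Kspace * baire |
  exists2 r, range e r & dens_seq (proj1_sig t.1) (to_cantor t.2) @ \oo --> r].
Proof.
apply: D11_ext (D11_bigcup (fun n => D11_dens_lim fstc sndc (b := fun=> e n) _)).
  move=> t /=; split=> [[n nr]|[_ [n _ <-] nr]]; last by exists n.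
  by exists (e n) => //; exists n.
by move=> n x; exact: cvg_cst.
Qed.

Lemma S11_outlier_countable (e : nat -> R) : S11 [set K : Kspace | exists x, outlier
  [set t | exists2 r, range e r &
    dens_seq (proj1_sig t.1) (to_cantor t.2) @ \oo --> r] (K, x)].
Proof.
apply: S11_proj; apply: D11_S11; apply: D11_setI.
  exact: (D11_dens_cvg fstc sndc).
by apply: D11_C; exact: D11_countable_lim.
Qed.

Lemma analytic_Kspace (A : set Kspace) : S11 A -> analytic A.
Proof. by have [p pc pT] := Kspace_surj; exact: S11_analytic pc pT. Qed.

(** Attaining each of the countably many required values is the analytic half, attaining no other
    one the coanalytic half. *)
Lemma countable_R_S_d2Sigma11 (S : set R) : S !=set0 -> countable S ->
  d2Sigma11 (R_S S).
Proof.
move=> S0 cS.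
have [e0 e0S] := countable_range S0 cS.
pose e n : R := match n with 0%N => 0 | 1%N => 1 | n'.+2 => e0 n' end.
have eS : range e = S `|` [set r : R | r = 0 \/ r = 1].
  rewrite -e0S; apply/seteqP; split=> [_ [[|[|n]] _ <-]|r [[n _ <-]|[->|->]]].
  - by right; left.
  - by right; right.
  - by left; exists n.
  - by exists n.+2.
  - by exists 0%N.
  - by exists 1%N.
exists [set K : Kspace | forall n, ran_density (proj1_sig K) (e n)],
  (~` [set K : Kspace | exists x, outlier [set t | exists2 r, range e r &
    dens_seq (proj1_sig t.1) (to_cantor t.2) @ \oo --> r] (K, x)]).
split; first by apply: analytic_Kspace; apply: S11_bigcap => n; exact: S11_ran_density.
split; first by rewrite /coanalytic setCK; apply: analytic_Kspace; exact: S11_outlier_countable.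
rewrite /R_S -eS; apply/seteqP; split=> K /=.
  move=> KE; split=> [n|]; first by rewrite KE; exists n.
  by apply/outlierP; rewrite KE.
move=> [eK /outlierP Ke]; apply/seteqP; split=> // _ [n _ <-]; exact: eK.
Qed.

Section Extremal.
Variables (K : Kspace).
Local Notation d := (rdens R (proj1_sig K)).

Lemma rdens01 u : 0 <= d u <= 1.
Proof.
rewrite (rdens_ge0 R (proj2_sig K) u) /=.
by apply: le_trans (rdens_le R (proj2_sig K) u) _; case: hits.
Qed.

Let dsplit := rdens_split R (proj2_sig K).

Lemma rdens_mono_cvg (z : cantor_space) : nondecreasing_seq (fun n => d (Defs.prefix z n)) ->
  exists2 r, d [::] <= r & dens_seq (proj1_sig K) z @ \oo --> r.
Proof.
move=> zn.
have zc : cvgn (fun n => d (Defs.prefix z n)).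
  apply: nondecreasing_is_cvgn => //; exists 1 => _ [n _ <-].
  by case/andP: (rdens01 (Defs.prefix z n)).
exists (limn (fun n => d (Defs.prefix z n))).
  exact: (nondecreasing_cvgn_le zn zc 0%N).
by rewrite (_ : dens_seq _ z = fun n => d (Defs.prefix z n))//;
  apply/funext => n; rewrite dens_seqE.
Qed.

Lemma rdens_mono_cvgN (z : cantor_space) : nondecreasing_seq (fun n => 1 - d (Defs.prefix z n)) ->
  exists2 r, r <= d [::] & dens_seq (proj1_sig K) z @ \oo --> r.
Proof.
move=> zn.
have zd : nonincreasing_seq (fun n => d (Defs.prefix z n)).
  by move=> m n /zn; rewrite lerD2l lerN2.
have zc : cvgn (fun n => d (Defs.prefix z n)).
  apply: nonincreasing_is_cvgn => //; exists 0 => _ [n _ <-].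
  by case/andP: (rdens01 (Defs.prefix z n)).
exists (limn (fun n => d (Defs.prefix z n))).
  exact: (nonincreasing_cvgn_ge zd zc 0%N).
by rewrite (_ : dens_seq _ z = fun n => d (Defs.prefix z n))//;
  apply/funext => n; rewrite dens_seqE.
Qed.

Lemma rdens_root_cvg (c : R) : (c = 0) \/ (c = 1) -> d [::] = c ->
  forall r, ran_density (proj1_sig K) r -> r = c.
Proof.
move=> c01 dc r [z zr].
have zc n : dens_seq (proj1_sig K) z n = c.
  rewrite dens_seqE; elim: n => [//|n IH]; rewrite prefixS.
  case: c01 IH => -> IH.
    exact: (martingale_rcons0 rdens01 dsplit).
  exact: (martingale_rcons1 rdens01 dsplit).
have cr : dens_seq (proj1_sig K) z @ \oo --> c.
  by rewrite (_ : dens_seq _ z = fun=> c); [exact: cvg_cst|exact/funext].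
exact: (@norm_cvg_unique _ R^o _ _ _ _ zr cr).
Qed.

(* Greedy paths have monotone, hence convergent, densities, so for a range included in {0, 1} the values 0 and 1 are attained under a Borel condition. *)
Lemma ran_density01P : ran_density (proj1_sig K) = [set r : R | r = 0 \/ r = 1] <->
  ran_density (proj1_sig K) `<=` [set r : R | r = 0 \/ r = 1] /\ 0 < d [::] < 1.
Proof.
split=> [KE|[K01 /andP[d0 d1]]].
  split; first by rewrite KE.
  have /andP[d0 d1] := rdens01 [::].
  rewrite !lt_neqAle d0 d1 !andbT; apply/andP; split; apply/negP => /eqP dE.
    have /esym := rdens_root_cvg (or_introl erefl) (esym dE) (r := 1) ltac:(by rewrite KE; right).
    by move/eqP; rewrite eq_sym oner_eq0.
  have := rdens_root_cvg (or_intror erefl) dE (r := 0) ltac:(by rewrite KE; left).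
  by move/eqP; rewrite eq_sym oner_eq0.
apply/seteqP; split=> // r.
have [z1 _ /rdens_mono_cvg[r1 dr1 zr1]] := martingale_up dsplit.
have [z0 _ /rdens_mono_cvgN[r0 dr0 zr0]] : exists2 z : cantor_space,
    1 - d [::] <= 1 - d (Defs.prefix z 0) &
    nondecreasing_seq (fun n => 1 - d (Defs.prefix z n)).
  apply: (martingale_up (d := fun u => 1 - d u)) => u.
  by rewrite dsplit; lra.
case=> ->.
  by have [<-|r01] := K01 r0 (ex_intro _ z0 zr0); [exists z0|lra].
by have [r10|<-] := K01 r1 (ex_intro _ z1 zr1); [lra|exists z1].
Qed.

End Extremal.

(** By [ran_density01P], attainment of 0 and 1 turns into a [D11] condition, so that the analytic
    half of the countable case disappears. *)
Lemma empty_R_S_coanalytic : coanalytic (R_S (@set0 R)).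
Proof.
pose e n : R := if n is 0%N then 0 else 1.
have eE : range e = [set r : R | r = 0 \/ r = 1].
  apply/seteqP; split=> [_ [[|n] _ <-]|r [->|->]]; [by left|by right|by exists 0%N|by exists 1%N].
pose O := [set K : Kspace | exists x, outlier [set t | exists2 r, range e r &
    dens_seq (proj1_sig t.1) (to_cantor t.2) @ \oo --> r] (K, x)].
have D1 := D11_rdens_lt [::] 1.
have D0 : D11 (~` [set K : Kspace | 0 < rdens R (proj1_sig K) [::]]).
  apply: D11_ext (D11_bigcap (fun n => D11_rdens_lt [::] n.+1%:R^-1)).
  move=> K /=; split=> [Kn K0|/negP]; last first.
    by rewrite -leNgt => K0 n; rewrite (le_lt_trans K0)// invr_gt0 ltr0n.
  have [n] := ltr_add_invr K0; rewrite add0r => /(lt_trans (Kn n)).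
  by rewrite ltxx.
apply: analytic_Kspace.
apply: S11_ext (S11_setU (S11_outlier_countable e) (S11_setU D0.1 D1.2)) => K.
rewrite /R_S /= set0U ran_density01P -eE outlierP.
rewrite -[X in _ <-> X]/(~ _).
split=> [[oK|[K0|K1]] [nO /andP[K0' K1']]//|H].
have [oK|nO] := pselect (O K); first by left.
right; have [K0|] := pselect (0 < rdens R (proj1_sig K) [::]); last by left.
right=> K1; apply: H; split=> //; exact/andP.
Qed.

Lemma analytic_R_S_Pi12 (S : set R) : S !=set0 -> analytic S -> Pi12 (R_S S).
Proof.
move=> S0 [SE|[f [fc fS]]]; first by move: S0; rewrite SE => -[].
pose L (c : R) : set Kspace := [set K : Kspace | ran_density (proj1_sig K) c].
pose lim_f (t : Kspace * baire) (y : baire) :=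
  dens_seq (proj1_sig t.1) (to_cantor t.2) @ \oo --> f y.
pose lim01 (t : Kspace * baire) := exists2 r : R, r = 0 \/ r = 1 &
  dens_seq (proj1_sig t.1) (to_cantor t.2) @ \oo --> r.
pose hit_f : set (Kspace * baire) := [set t | exists x, lim_f (t.1, x) t.2].
pose in_f : set (Kspace * baire) := [set t | exists y, lim_f t y].
pose out : set (Kspace * baire) := outlier [set t | in_f t \/ lim01 t].
have Shit : S11 hit_f.
  apply: (S11_proj (A := [set s : Kspace * baire * baire |
    lim_f (s.1.1, s.2) s.1.2])).
  apply: D11_S11.
  apply: (@D11_dens_lim (Kspace * baire * baire)%type (fun s => s.1.1) (fun s => s.2)
    _ _ (fun s => f s.1.2)).
  - exact: (@continuous_comp_fun _ (Kspace * baire)%type _ _ _ (@continuous_fst _ _) fstc).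
  - exact: continuous_snd.
  - apply: (@continuous_comp_fun _ baire R (fun s => s.1.2) _ _ fc).
    exact: (@continuous_comp_fun _ (Kspace * baire)%type _ _ _ (@continuous_fst _ _) sndc).
have Sin : S11 in_f.
  apply: (S11_proj (A := [set s : Kspace * baire * baire | lim_f s.1 s.2])).
  apply: D11_S11.
  apply: (@D11_dens_lim (Kspace * baire * baire)%type (fun s => s.1.1) (fun s => s.1.2)
    _ _ (fun s => f s.2)).
  - exact: (@continuous_comp_fun _ (Kspace * baire)%type _ _ _ (@continuous_fst _ _) fstc).
  - exact: (@continuous_comp_fun _ (Kspace * baire)%type _ _ _ (@continuous_fst _ _) sndc).
  - exact: (@continuous_comp_fun _ baire R _ _ (@continuous_snd _ _) fc).
have S01 : S11 [set t | lim01 t].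
  apply: S11_ext (S11_setU (D11_S11 (D11_dens_lim fstc sndc (b := fun=> 0) _))
    (D11_S11 (D11_dens_lim fstc sndc (b := fun=> 1) _))).
  - move=> t; split=> [[t0|t1]|[r [->|->] tr]]; [by exists 0; [left|]|
      by exists 1; [right|]|by left|by right].
  - by move=> x; exact: cvg_cst.
  - by move=> x; exact: cvg_cst.
have Snout : S11 (~` out).
  rewrite /out /outlier setCI setCK.
  by apply: S11_setU (S11_setU Sin S01); exact: (D11_dens_cvg fstc sndc).2.
(* One existential [x] serves two failures: as a parameter, it gives a value [f x] that is not
   attained; as a point, it has a density outside the required set. The last disjunct covers a
   missing 0 or 1. *)
pose B := ~` hit_f `|` (out `|` fst @^-1` (~` (L 0 `&` L 1))).
exists B; split.
  have [p pc pT] := Kspace_baire_surj.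
  apply: (S11_analytic pc pT); rewrite /B !setCU setCK.
  apply: S11_setI => //; apply: S11_setI => //; rewrite -preimage_setC setCK.
  by apply: (S11_preimage fstc); apply: S11_setI; exact: S11_ran_density.
have SE : S `|` [set r : R | r = 0 \/ r = 1] = [set r | (exists y, f y = r) \/ (r = 0 \/ r = 1)].
  by rewrite -fS; apply/seteqP; split=> r [[y]|r01]; [move=> _ yr; left; exists y|right|move=> yr; left; exists y|right].
have outP (K : Kspace) : ran_density (proj1_sig K) `<=` S `|` [set r : R | r = 0 \/ r = 1]
    <-> ~ exists x, out (K, x).
  rewrite outlierP SE /out /outlier.
  have -> // : [set t : Kspace * baire | exists2 r,
      [set r0 | (exists y, f y = r0) \/ r0 = 0 \/ r0 = 1] r &
      dens_seq (proj1_sig t.1) (to_cantor t.2) @ \oo --> r] = [set t | in_f t \/ lim01 t].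
  apply/seteqP; split=> t.
    by move=> [r [[y <-]|r01] tr]; [left; exists y|right; exists r].
  by move=> [[y ty]|[r r01 tr]]; [exists (f y) => //; left; exists y|exists r => //; right].
apply/seteqP; split=> [K nK|_ [[K x] BK <-] /= KE].
  have [oK|nO] := pselect (exists x, out (K, x)).
    by case: oK => x ox; exists (K, x) => //; right; left.
  have [L01|nL] := pselect ((L 0 `&` L 1) K); last first.
    by exists (K, (fun=> 0%N)) => //; right; right.
  have [hK|/existsNP[x nx]] := pselect (forall x, hit_f (K, x)); last first.
    by exists (K, x) => //; left.
  exfalso; apply: nK; apply/seteqP; split; first exact/outP.
  rewrite SE => r [[y <-]|[->|->]]; last 2 first.
  - by case: L01.
  - by case: L01.
  by have [x xy] := hK y; exists (to_cantor x).
case: BK => [nh|[ox|nL]].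
- apply: nh; have /ran_densityE[y yr] : ran_density (proj1_sig K) (f x).
    by rewrite KE; left; rewrite -fS; exists x.
  by exists y.
- have /outP noK : ran_density (proj1_sig K) `<=` S `|` [set r : R | r = 0 \/ r = 1].
    by rewrite KE.
  by apply: noK; exists x.
- by apply: nL; split; rewrite /L /= KE; right; [left|right].
Qed.

End Complexity.

(** * Hardness *)

(** Baire category: complements of points are open and dense in the line. *)
Lemma exists_notin_countable (R : realType) (S : set R) : countable S ->
  exists2 r, 0 < r < 1 & ~ S r.
Proof.
move=> cS; have [->|/set0P S0] := eqVneq S set0; first by exists 2^-1 => //; lra.
have [e <-] := countable_range S0 cS.
have [|||r [r01 re]] := @Baire _ R^o (fun n => ~` [set e n]) _ `]0, 1[%classic.
- move=> n; split; first by rewrite openC; exact: closed_eq.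
  move=> O [y Oy] oO; have [ye|ye] := eqVneq y (e n); last by exists y; split=> // /eqP; exact/negP.
  have /nbhs_ballP[d /= d0 dO] := open_nbhs_nbhs (conj oO Oy).
  exists (y + d / 2); split; last by rewrite -ye /=; lra.
  by apply: dO; rewrite -ball_normE /= opprD addrA subrr sub0r normrN ger0_norm; lra.
- by exists 2^-1; rewrite /= in_itv/=; lra.
- exact: interval_open.
exists r; first by move: r01; rewrite /= in_itv.
by move=> [n _ nr]; exact: (re n).
Qed.

(** For each pair of basic balls that some clopen set separates, one such set is chosen; there are
    countably many pairs. *)
Lemma separating_clopens (R : realType) (Z : completePseudoMetricType R) :
  zd_polish Z -> exists V : nat -> set Z, (forall n, clopen (V n)) /\
    forall x y, x <> y -> exists n, V n x /\ ~ V n y.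
Proof.
move=> [_ [[D [cD DT]] [hZ zd]]].
have [z0|nz] := pselect (exists z : Z, True); last first.
  by exists (fun=> set0); split=> [n|x]; [split; [exact: open0|exact: closed0]|case: nz; exists x].
have D0 : D !=set0.
  case: z0 => z _; have : closure D z by rewrite DT.
  by move=> /(_ _ filterT)[d [Dd _]]; exists d.
have [e eD] := countable_range D0 cD.
pose B (p : nat * nat) : set Z := ball (e p.1) (p.2.+1%:R^-1 : R).
have BP x U : open U -> U x -> exists p, B p x /\ B p `<=` U.
  rewrite openE => oU /oU/nbhs_ballP[r /= r0 rU].
  have [n] := ltr_add_invr (y := 0) (x := r / 2) ltac:(by rewrite divr_gt0).
  rewrite add0r => nr.
  have n0 : 0 < n.+1%:R^-1 :> R by rewrite invr_gt0 ltr0n.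
  have : closure D x by rewrite DT.
  move=> /(_ _ (nbhsx_ballx x _ n0))[d []]; rewrite -eD => -[i _ <-] xd.
  exists (i, n); split=> [|y dy]; first exact: ball_sym.
  apply: rU; rewrite (splitr r); apply: (ball_triangle (y := e i)).
    by apply: le_ball xd; exact: ltW.
  by apply: le_ball dy; exact: ltW.
have /choice[W WP] : forall q : (nat * nat) * (nat * nat), exists V : set Z,
    clopen V /\ ((exists V', [/\ clopen V', B q.1 `<=` V' & B q.2 `<=` ~` V']) ->
      B q.1 `<=` V /\ B q.2 `<=` ~` V).
  move=> q; have [[V [cV qV qV']]|nV] := pselect (exists V',
    [/\ clopen V', B q.1 `<=` V' & B q.2 `<=` ~` V']); first by exists V.
  by exists set0; split=> //; split; [exact: open0|exact: closed0].
exists (fun n => if choice.unpickle n is Some q then W q else set0).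
split=> [n|x y xy].
  by case: choice.unpickle => [q|]; [exact: (WP q).1|split; [exact: open0|exact: closed0]].
have [V [cV [Vx Vy]]] : exists V, clopen V /\ V x /\ ~ V y.
  have : exists2 U : set Z, open U & U x /\ ~ U y.
    have := hZ; rewrite open_hausdorff => /(_ x y); rewrite (introF eqP xy) => /(_ isT).
    case=> -[P Q] /= [/set_mem Px /set_mem Qy] [oP oQ PQ]; exists P => //; split=> // Py.
    by have : (P `&` Q) y by []; rewrite (eqP PQ).
  by move=> [U oU [Ux nUy]]; have [V [cV [Vx VU]]] := zd x U oU Ux; exists V;
    split=> //; split=> // /VU.
have [p [Bpx pV]] := BP x V cV.1 Vx.
have [|p' [Bpy pV']] := BP y (~` V) _ Vy; first by rewrite openC; exact: cV.2.
exists (choice.pickle (p, p')); rewrite choice.pickleK.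
have [W1 W2] := (WP (p, p')).2 (ex_intro _ V (And3 cV pV pV')).
by split; [exact: W1|exact: W2].
Qed.

Lemma zd_polish_injection (R : realType) (Z : completePseudoMetricType R) :
  zd_polish Z -> exists2 c : Z -> baire, continuous c & injective c.
Proof.
move=> /separating_clopens[V [cV VP]].
exists (fun z n => nat_of_bool `[< V n z >]).
  apply: (@continuous_seqspace nat) => n z.
  have [Vz|nVz] := pselect (V n z).
    apply: filterS (open_nbhs_nbhs (conj (cV n).1 Vz)) => y Vy.
    by rewrite !asboolT.
  have oC : open (~` V n) by rewrite openC; exact: (cV n).2.
  apply: filterS (open_nbhs_nbhs (conj oC nVz)) => y Vy.
  by rewrite !asboolF.
move=> x y cxy; apply: contrapT => /VP[n [Vx Vy]].
by have := congr1 (fun u : baire => u n) cxy; rewrite asboolT// asboolF.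
Qed.

(** [U s t] says that some [y] extending [t] has [c (g y)] extending [s]. If this holds along all
    initial segments of [c x] and of a fixed [y], continuity gives [c (g y) = c x], and injectivity
    [g y = x]. *)
Lemma analytic_normal_form (X : topologicalType) (c : X -> baire) (A : set X) :
  continuous c -> injective c -> analytic A ->
  exists U : seq nat -> seq nat -> bool,
    forall x, A x <-> exists y : baire, forall n, U (mkseq (c x) n) (mkseq y n).
Proof.
move=> cc ci [->|[g [gc <-]]].
  by exists (fun _ _ => false) => x; split=> // -[y /(_ 0%N)].
exists (fun s t => `[< exists y : baire,
  mkseq (c (g y)) (size s) = s /\ mkseq y (size t) = t >]) => x.
split=> [[y _ <-]|[y yU]].
  by exists y => n; apply/asboolP; exists y; rewrite !size_mkseq.
have cgc : continuous (fun y => c (g y)).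
  exact: (@continuous_comp_fun _ X baire _ _ gc cc).
exists y => //; apply: ci; apply/funext => i.
have /(@nbhs_agreeP nat)[n ny] := @continuous_coord nat _ _ i y cgc.
have /asboolP[y' []] := yU (maxn n i.+1); rewrite !size_mkseq.
move=> /mkseq_agree cy' /mkseq_agree yy'.
rewrite -cy' ?leq_max ?ltnSn ?orbT// ny// => j jn.
by rewrite yy'// leq_max jn.
Qed.

Lemma near_mkseq (X : topologicalType) (c : X -> baire) (n : nat) (x : X) :
  continuous c -> \forall x' \near x, mkseq (c x') n = mkseq (c x) n.
Proof.
move=> cc; have : \forall x' \near x, agree n (c x) (c x').
  exact: (cc x _ (@near_agree nat (c x) n)).
apply: filterS => x' xx'; apply/eq_in_map => i; rewrite mem_iota => /xx' ->.
by [].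
Qed.

Lemma continuous_tail : continuous (tail : baire -> baire).
Proof. exact: continuous_reindex. Qed.

(** The first entry of a sequence names the piece and the others form its argument; entries naming
    no index are dead at once. *)
Lemma density_pieces (R : realType) (T : topologicalType) (I : countType)
  (phi : I -> baire -> R) (live : I -> T -> seq nat -> bool) :
  (forall i y, 0 < phi i y < 1) -> (forall i, continuous (phi i)) ->
  (forall i s t, \forall t' \near t, live i t' s = live i t s) ->
  exists2 f : T -> Kspace, continuous f & forall t, ran_density (proj1_sig (f t)) =
    [set r | exists i (y : baire), (forall n, live i t (mkseq y n)) /\ phi i y = r]
    `|` [set r | r = 0 \/ r = 1].
Proof.
move=> phi01 phic live_near.
pose ph (y : baire) : R :=
  if @choice.unpickle I (y 0%N) is Some i then phi i (tail y) else 2^-1.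
pose lv t (s : seq nat) := if s is a :: s' then
  (if @choice.unpickle I a is Some i then live i t s' else false) else true.
have [||||f fc fE] := @density_construction R ph T lv; last 1 first.
- exists f => // t; rewrite fE; congr (_ `|` _).
  have mkS (y : baire) n : mkseq y n.+1 = y 0%N :: mkseq (tail y) n.
    by rewrite /mkseq /= -[1%N]/(1 + 0)%N iotaDl -map_comp.
  apply/seteqP; split=> r.
    move=> [y ly <-]; rewrite /ph; have := ly 1%N; rewrite mkS /lv.
    case E : choice.unpickle => [i|//] _; exists i, (tail y); split=> // n.
    by have := ly n.+1; rewrite mkS /lv E.
  move=> [i [y [ly <-]]]; exists (push (choice.pickle i) y).
    by case=> [//|n]; rewrite mkS /lv /= choice.pickleK; exact: ly.
  by rewrite /ph /= choice.pickleK.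
- by move=> y; rewrite /ph; case: choice.unpickle => [i|]; [exact: phi01|lra].
- move=> y; apply/cvgrPdist_lt => e e0.
  have y0 := @near_seqspace_coord nat y 0.
  case E : (@choice.unpickle I (y 0%N)) => [i|]; last first.
    by apply: filterS y0 => x; rewrite /ph => ->; rewrite E subrr normr0.
  have pc : continuous (fun x : baire => phi i (tail x)).
    exact: (@continuous_comp_fun _ baire R _ _ continuous_tail (phic i)).
  have /cvgrPdist_lt/(_ e e0) py := @pc y.
  by apply: filterS2 y0 py => x; rewrite /ph => ->; rewrite E.
- by [].
- case=> [|a s] t /=; first exact: nearW.
  by case: choice.unpickle => [i|]; [exact: live_near|exact: nearW].
Qed.

Section Hardness.
Variable R : realType.

Lemma ran_eq_R_S (S : set R) (K : Kspace) :
  S `<=` `]0, 1[ -> forall E : set R, (E `<=` `]0, 1[) ->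
  ran_density (proj1_sig K) = E `|` [set r | r = 0 \/ r = 1] ->
  (R_S S K <-> E = S).
Proof.
move=> S01 E E01 KE; rewrite /R_S /= KE; split=> [ES|->//].
have sub (A B : set R) : A `<=` `]0, 1[ ->
    A `|` [set r | r = 0 \/ r = 1] = B `|` [set r | r = 0 \/ r = 1] -> A `<=` B.
  move=> A01 AB r Ar; have : (B `|` [set r | r = 0 \/ r = 1]) r by rewrite -AB; left.
  by case=> // r01; have := A01 _ Ar; rewrite /= in_itv/=; case: r01 => ->; lra.
by apply/seteqP; split; exact: sub.
Qed.

Variable Z : completePseudoMetricType R.
Hypothesis zdZ : zd_polish Z.

(** A single piece of constant value 1/2, live while the normal form of the complement of [B] is
    obeyed: 1/2 is attained exactly for [t] outside [B]. *)
Lemma empty_R_S_hard (B : set Z) : coanalytic B ->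
  exists f : Z -> Kspace, continuous f /\ B = f @^-1` R_S (@set0 R).
Proof.
move=> aB; have [c cc ci] := zd_polish_injection zdZ.
have [U UB] := analytic_normal_form cc ci aB.
have [||_ s t|f fc fE] := @density_pieces R Z unit (fun _ _ => 2^-1)
    (fun _ t s => U (mkseq (c t) (size s)) s).
- by move=> _ _; lra.
- by move=> _ y; exact: cvg_cst.
- by apply: filterS (near_mkseq (size s) t cc) => t' ->.
exists f; split=> //; apply/seteqP.
suff H t : R_S (@set0 R) (f t) <-> B t by split=> t; [move=> /(H t)|move=> ?; exact/(H t)].
rewrite (ran_eq_R_S _ _ (fE t)) => [|r //|r [_ [y [_ <-]]]]; last first.
  by rewrite /= in_itv/=; lra.
have UBt : ~ B t <-> exists y : baire, forall n, U (mkseq (c t) n) (mkseq y n) := UB t.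
split=> [E|Bt]; last first.
  apply/seteqP; split=> // r [_ [y [ly _]]]; have : ~ B t.
    by apply/UBt; exists y => n; have := ly n; rewrite size_mkseq.
  by [].
apply: contrapT => /UBt[y yU]; suff : (@set0 R) 2^-1 by [].
by rewrite -E; exists tt, y; split=> // n; rewrite size_mkseq.
Qed.

(** A value [s0] of [S] is attained exactly for [t] in [A], a value [r1] outside [S] exactly for [t]
    outside [C], and the rest of [S] always; the guard [e n != s0] keeps the enumeration from
    supplying [s0]. *)
Lemma countable_R_S_hard (S : set R) (B : set Z) : S `<=` `]0, 1[ ->
  S !=set0 -> countable S -> d2Sigma11 B ->
  exists f : Z -> Kspace, continuous f /\ B = f @^-1` R_S S.
Proof.
move=> S01 S0 cS [A [C [aA [aC ->]]]].
have [e eS] := countable_range S0 cS.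
have Se n : S (e n) by rewrite -eS; exists n.
have [r1 r101 nSr1] := exists_notin_countable cS.
have [s0 Ss0] := S0.
have [c cc ci] := zd_polish_injection zdZ.
have [U UA] := analytic_normal_form cc ci aA.
have [V VC] := analytic_normal_form cc ci aC.
pose val (i : bool + nat) : R := match i with
  | inl true => s0 | inl false => r1 | inr n => e n end.
pose live (i : bool + nat) (t : Z) (s : seq nat) : bool := match i with
  | inl true => U (mkseq (c t) (size s)) s
  | inl false => V (mkseq (c t) (size s)) s
  | inr n => e n != s0 end.
have val01 i : 0 < val i < 1.
  by case: i => [[]|n] //=; [have := S01 _ Ss0|have := S01 _ (Se n)];
    rewrite /= in_itv.
have [||i s t|f fc fE] := @density_pieces R Z (bool + nat)%type
    (fun i _ => val i) live.
- by move=> i _; exact: val01.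
- by move=> i y; exact: cvg_cst.
- case: i => [[]|n] /=; last exact: nearW;
    by apply: filterS (near_mkseq (size s) t cc) => t' ->.
exists f; split=> //; apply/seteqP.
suff H t : R_S S (f t) <-> A t /\ C t by split=> t; [move=> /(H t)|move=> ?; exact/(H t)].
rewrite (ran_eq_R_S S01 _ (fE t)); last first.
  by move=> r [i [y [_ <-]]]; rewrite /= in_itv/= val01.
have UAt := UA t.
have VCt : ~ C t <-> exists y : baire, forall n, V (mkseq (c t) n) (mkseq y n) := VC t.
split=> [E|[At Ct]].
  split.
    have : S s0 by []; rewrite -E => -[[[]|n] [y [ly /= vE]]].
    - by apply/UAt; exists y => n; have := ly n; rewrite /live size_mkseq.
    - by case: nSr1; rewrite vE.
    - by have := ly 0%N; rewrite /live vE eqxx.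
  apply: contrapT => /VCt[y yV]; apply: nSr1; rewrite -E.
  by exists (inl false), y; split=> // n; rewrite /live size_mkseq.
apply/seteqP; split=> r.
  move=> [[[]|n] [y [ly /= <-]]] //.
  suff : ~ C t by [].
  by apply/VCt; exists y => n; have := ly n; rewrite /live size_mkseq.
rewrite -eS => -[n _ <-]; have [es|es] := eqVneq (e n) s0; last first.
  by exists (inr n), (fun=> 0%N).
have /UAt[y yU] := At.
by exists (inl true), y; split=> // k; rewrite /live size_mkseq.
Qed.

End Hardness.

(** * A perfect set theorem *)

Definition node (s : seq nat) : set baire := [set y | mkseq y (size s) = s].

Lemma take_mkseq (y : nat -> nat) (m n : nat) : (m <= n)%N ->
  take m (mkseq y n) = mkseq y m.
Proof. by move=> mn; rewrite /mkseq -map_take take_iota (minn_idPl mn). Qed.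

Section PerfectSet.
Variables (T : topologicalType) (f : baire -> T).
Hypotheses (hT : hausdorff_space T) (fc : continuous f).

Let big (s : seq nat) : Prop := ~ countable (f @` node s).

Lemma big_split (s : seq nat) : big s -> exists t : bool -> seq nat,
  [/\ forall b, big (t b), forall b, (size s < size (t b))%N,
      forall b, take (size s) (t b) = s &
      f @` node (t false) `&` f @` node (t true) = set0].
Proof.
move=> bs.
(* A countable set; a point mapped outside it has only initial segments whose nodes have uncountable
   image. *)
pose C : set T := \bigcup_(s' in [set s' | countable (f @` node s')]) (f @` node s').
have cC : countable C by apply: bigcup_countable => //; exact: countableP.
have bigC y n : ~ C (f y) -> big (mkseq y n).
  move=> nC cy; apply: nC; exists (mkseq y n) => //.
  by exists y => //; rewrite /node /= size_mkseq.
have [y0 [y1 [sy0 sy1 [C0 C1] y01]]] : exists y0 y1,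
    [/\ node s y0, node s y1, ~ C (f y0) /\ ~ C (f y1) & f y0 <> f y1].
  (* Otherwise the image of [node s] would lie in [C] together with one further point. *)
  apply: contrapT => H; apply: bs.
  have [[y0 [sy0 C0]]|/forallNP nC] := pselect (exists y, node s y /\ ~ C (f y)).
    apply: (@sub_countable _ _ _ (\bigcup_(b in [set: bool]) (if b then C else [set f y0]))).
    2: by apply: bigcup_countable => // -[].
    apply: subset_card_le => _ [y sy <-].
    have [?|Cy] := pselect (C (f y)); first by exists true.
    exists false => //=; apply: contrapT => yy0; apply: H; exists y, y0; split=> //.
  apply: sub_countable cC; apply: subset_card_le => _ [y sy <-].
  by apply: contrapT => Cy; apply: (nC y).
have [[P Q] /= [/set_mem P0 /set_mem Q1] [oP oQ /eqP PQ]] : exists2 PQ : set T * set T,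
    f y0 \in PQ.1 /\ f y1 \in PQ.2 & [/\ open PQ.1, open PQ.2 & PQ.1 `&` PQ.2 == set0].
  by have := hT; rewrite open_hausdorff => /(_ (f y0) (f y1)); rewrite (introF eqP y01);
    move=> /(_ isT)[[P Q] ? ?]; exists (P, Q).
have sep (y : baire) (O : set T) : open O -> O (f y) ->
    exists n, forall x, agree n y x -> O (f x).
  move=> oO Oy; have : nbhs y (f @^-1` O) by apply: fc; exact: open_nbhs_nbhs.
  by move=> /(@nbhs_agreeP nat).
have [n0 H0] := sep _ _ oP P0; have [n1 H1] := sep _ _ oQ Q1.
exists (fun b => if b then mkseq y1 (maxn n1 (size s).+1) else mkseq y0 (maxn n0 (size s).+1)).
split.
- by case; exact: bigC.
- by case; rewrite size_mkseq leq_maxr.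
- by case; rewrite take_mkseq// leq_max leqnSn orbT.
apply/seteqP; split=> // _ [[x x0 <-] [x' x1 xx']].
have : (P `&` Q) (f x); last by rewrite PQ.
split.
  apply: H0 => i i_n; move: x0; rewrite /node /= size_mkseq => /mkseq_agree ->//.
  by rewrite leq_max i_n.
rewrite -xx'; apply: H1 => i i_n; move: x1; rewrite /node /= size_mkseq => /mkseq_agree ->//.
by rewrite leq_max i_n.
Qed.

(** A Cantor scheme of nodes with uncountable image: at the first place where two branches differ,
    the images of the two successors are disjoint. *)
Lemma perfect_set_theorem : ~ countable (range f) ->
  exists h : cantor_space -> T, [/\ continuous h, injective h & range h `<=` range f].
Proof.
move=> nc.
have big0 : big [::].
  by apply: contra_not nc; rewrite (_ : node [::] = setT)//; apply/seteqP.
have /choice[g gP] : forall s, exists t : bool -> seq nat, big s ->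
    [/\ forall b, big (t b), forall b, (size s < size (t b))%N,
      forall b, take (size s) (t b) = s &
      f @` node (t false) `&` f @` node (t true) = set0].
  move=> s; have [/big_split[t tP]|ns] := pselect (big s); first by exists t.
  by exists (fun=> s) => /ns.
pose fix tr (w : nat -> bool) m : seq nat :=
  if m is m'.+1 then g (tr w m') (w m') else [::].
have trB w m : big (tr w m).
  by elim: m => //= m IH; have [] := gP _ IH.
have sz w m : (m <= size (tr w m))%N.
  elim: m => //= m IH; have [_ h _ _] := gP _ (trB w m).
  exact: leq_ltn_trans IH (h _).
have pre w m n : (m <= n)%N -> take (size (tr w m)) (tr w n) = tr w m.
  move=> /subnKC <-; elim: (n - m)%N => [|k IH]; first by rewrite addn0 take_size.
  rewrite addnS /=; have [_ h1 h2 _] := gP _ (trB w (m + k)%N).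
  rewrite -[RHS]IH -[in RHS](h2 (w (m + k)%N)) take_takel//.
  by rewrite -IH size_take_min geq_minr.
pose y w : baire := fun i => nth 0%N (tr w i.+1) i.
have yw w m : node (tr w m) (y w).
  apply: (@eq_from_nth _ 0%N) => [|i]; rewrite size_mkseq// => im.
  rewrite nth_mkseq// /y; have iSi := sz w i.+1.
  have [im'|im'] := leqP i.+1 m; first by rewrite -(pre w _ _ im') nth_take.
  by rewrite -[in RHS](pre w _ _ (ltnW im')) nth_take.
have tr_agree w w' m : agree m w w' -> tr w m = tr w' m.
  elim: m => //= m IH ww'; rewrite IH ?ww'// => i im; apply: ww'.
  exact: ltnW.
exists (fun w => f (y w)); split.
- apply: (@continuous_comp_fun _ baire T _ _ _ fc).
  apply: (@continuous_seqspace nat) => i w.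
  apply: filterS (@near_agree bool w i.+1) => w' ww'.
  by rewrite /y (tr_agree _ _ _ ww').
- move=> w w' ww'; apply/funext => i; apply: contrapT => wi.
  have [m wm mmin] : exists2 m, w m != w' m & forall k, (k < m)%N -> w k = w' k.
    have ex : exists m, w m != w' m by exists i; exact/eqP.
    case: (ex_minnP ex) => m wm mmin; exists m => // k km.
    by apply: contrapT => /eqP /mmin; rewrite leqNgt km.
  have trE : tr w m = tr w' m by apply: tr_agree => k /mmin.
  have [_ _ _ dis] := gP _ (trB w m).
  have h : (f @` node (g (tr w m) (w m))) (f (y w)) by exists (y w) => //; exact: (yw w m.+1).
  have h' : (f @` node (g (tr w m) (w' m))) (f (y w)).
    by exists (y w') => //; rewrite trE; exact: (yw w' m.+1).
  have : (f @` node (g (tr w m) false) `&` f @` node (g (tr w m) true)) (f (y w)).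
    by move: wm h h'; case: (w m); case: (w' m).
  by rewrite dis.
- by move=> _ [w _ <-]; exists (y w).
Qed.

End PerfectSet.

Definition decode (k : nat) : nat * nat :=
  if @choice.unpickle (nat * nat)%type k is Some p then p else (0%N, 0%N).

Lemma pair_codeK (i j : nat) : decode (pair_code i j) = (i, j).
Proof. by rewrite /decode /pair_code choice.pickleK. Qed.

Lemma foldl_code (w : nat -> bool) (m : nat) :
  foldl code_step ([::], 0%N) (mkseq w m) = code w m.
Proof. by elim: m => // m IH; rewrite mkseqS -cats1 foldl_cat IH. Qed.

Definition concat (s : seq nat) (v : baire) : baire :=
  fun i => if (i < size s)%N then nth 0%N s i else v (i - size s)%N.

Lemma continuous_concat (s : seq nat) : continuous (concat s).
Proof.
apply: (@continuous_seqspace nat) => i v.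
apply: filterS (@near_seqspace_coord nat v (i - size s)%N) => x /= xv.
by rewrite /concat xv.
Qed.

(** * Hardness for uncountable [S] *)

Section UncountableHardness.
Variables (R : realType) (S : set R).
Hypothesis S01 : S `<=` `]0, 1[.
Variable Z : completePseudoMetricType R.
Hypothesis zdZ : zd_polish Z.

(** The values of [S] outside [range h], and [h w] for [w] eventually 0, are always attained; for
    [w] coding [x], [h w] is attained exactly if [(t, x)] is outside [C]. So all of [S] is attained
    exactly for [t] in [B]. *)
Lemma uncountable_R_S_hard (B : set Z) : analytic S -> ~ countable S -> Pi12 B ->
  exists f : Z -> Kspace, continuous f /\ B = f @^-1` R_S S.
Proof.
move=> [->|[f [fc fS]]] nS; first by case: nS.
have [|h [hc hi hf]] := perfect_set_theorem (@norm_hausdorff _ R^o) fc.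
  by rewrite fS.
move=> [C [aC BC]]; have [c cc ci] := zd_polish_injection zdZ.
(* Entrywise pairing: [n] entries of [c' (t, x)] need only [n] entries of [x], so [live] can work
   with the part of [x] decoded so far. *)
pose c' (p : Z * baire) : baire := fun i => pair_code (c p.1 i) (p.2 i).
have cc' : continuous c'.
  apply: (@continuous_seqspace nat) => i p.
  have c1 : \forall q \near p, c q.1 i = c p.1 i :> nat.
    apply: (@continuous_coord nat _ (fun q : Z * baire => c q.1) i p).
    exact: (@continuous_comp_fun _ Z baire _ _ (@continuous_fst _ _) cc).
  have c2 : \forall q \near p, q.2 i = p.2 i :> nat.
    exact: (@continuous_coord nat _ (fun q : Z * baire => q.2) i p (@continuous_snd _ _)).
  by apply: filterS2 c1 c2 => q; rewrite /c' => -> ->.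
have ci' : injective c'.
  move=> [z x] [z' x'] zx; have zxi i : c z i = c z' i /\ x i = x' i.
    have := congr1 (fun u : baire => decode (u i)) zx.
    by rewrite /c' !pair_codeK => -[].
  congr pair; last by apply/funext => i; have [] := zxi i.
  by apply: ci; apply/funext => i; have [] := zxi i.
have [U UC] := analytic_normal_form cc' ci' aC.
have BP t : B t <-> forall x, exists y : baire,
    forall n, U (mkseq (c' (t, x)) n) (mkseq y n).
  have nB : ~ B t <-> exists x, C (t, x).
    rewrite -[~ B t]/((~` B) t) BC; split=> [[[z x] Czx /= <-]|[x Cx]].
      by exists x.
    by exists (t, x).
  split=> [Bt x|H].
    by apply/UC => Cx; have : ~ B t by apply/nB; exists x.
  by apply: contrapT => /nB[x Cx]; have /UC := H x.
(* An argument of the first piece packs two sequences: [w] in its first coordinates, the witness in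
   its second ones. *)
pose bits (v : baire) : cantor_space := fun i => (decode (v i)).1 != 0%N.
pose phi (i : (unit + seq bool) + seq nat) (v : baire) : R :=
  match i with
  | inl (inl _) => h (bits v)
  | inl (inr u) => h (fun i => nth false u i)
  | inr s => f (concat s v)
  end.
pose live (i : (unit + seq bool) + seq nat) (t : Z) (u : seq nat) : bool :=
  match i with
  | inl (inl _) =>
      (* The decoded part of [x] may be shorter than [u], so the witness is cut to the same
         length. *)
      let x := (foldl code_step ([::], 0%N) [seq (decode k).1 != 0%N | k <- u]).1 in
      U [seq pair_code p.1 p.2 | p <- zip (mkseq (c t) (size x)) x]
        (take (size x) [seq (decode k).2 | k <- u])
  | inl (inr _) => true
  | inr s => `[< forall v, ~ range h (f (concat s v)) >]
  end.
have Sf y : S (f y) by rewrite -fS; exists y.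
have Sh w : S (h w) by rewrite -fS; apply: hf; exists w.
have Sphi i v : S (phi i v) by case: i => [[a|u]|s] /=.
have bc : continuous bits.
  apply: (@continuous_seqspace bool) => i v.
  by apply: filterS (@near_seqspace_coord nat v i) => v'; rewrite /bits => ->.
have [||i s t|g gc gE] := @density_pieces R Z ((unit + seq bool) + seq nat)%type phi live.
- by move=> i v; have := S01 (Sphi i v); rewrite /= in_itv.
- case=> [[a|u]|s] /=.
  + exact: (@continuous_comp_fun _ cantor_space R _ _ bc hc).
  + by move=> v; exact: cvg_cst.
  + exact: (@continuous_comp_fun _ baire R _ _ (@continuous_concat s) fc).
- case: i => [[a|u]|s'] /=; [|exact: nearW|exact: nearW].
  set x := (foldl _ _ _).1.
  by apply: filterS (near_mkseq (size x) t cc) => t' ->.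
exists g; split=> //; apply/seteqP.
suff H t : R_S S (g t) <-> B t by split=> t; [move=> /(H t)|move=> ?; exact/(H t)].
rewrite (ran_eq_R_S S01 _ (gE t)); last first.
  by move=> r [i [v [_ <-]]]; exact: S01.
have liveE v x m : (code (bits v) m).1 = mkseq x (size (code (bits v) m).1) ->
    live (inl (inl tt)) t (mkseq v m) =
    U (mkseq (c' (t, x)) (size (code (bits v) m).1))
      (mkseq (fun i => (decode (v i)).2) (size (code (bits v) m).1)).
  move=> xE; rewrite /live.
  have -> : [seq (decode k).1 != 0%N | k <- mkseq v m] = mkseq (bits v) m.
    by rewrite /mkseq -map_comp.
  have -> : [seq (decode k).2 | k <- mkseq v m] = mkseq (fun i => (decode (v i)).2) m.
    by rewrite /mkseq -map_comp.
  rewrite foldl_code /= take_mkseq ?size_code_le//.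
  congr U; rewrite {2}xE; set k := size _.
  apply: (@eq_from_nth _ 0%N) => [|i].
    by rewrite size_map size_zip !size_mkseq minnn.
  rewrite size_map size_zip !size_mkseq minnn => ik.
  rewrite (nth_map (0%N, 0%N)) ?size_zip ?size_mkseq ?minnn//.
  by rewrite nth_zip ?size_mkseq//= !nth_mkseq.
split=> [E|Bt].
  apply/BP => x; have [w wx wn] := code_exists x.
  (* As [w] has infinitely many 1s, [h w] can come from the first piece only: the second uses
     eventually zero sequences, the third avoids [range h]. *)
  have : S (h w) by []; rewrite -E => -[[[[]|u]|s] [v [lv /= vE]]].
  - have wE : bits v = w by exact: hi.
    exists (fun i => (decode (v i)).2) => n; have [m mn] := size_code_onto wn n.
    have wxm : (code (bits v) m).1 = mkseq x (size (code (bits v) m).1).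
      by rewrite wE; exact: wx.
    by move: (lv m); rewrite (liveE v x m wxm) wE mn; exact.
  - have wE := hi _ _ vE; exfalso.
    have bound m : (size (code w m).1 <= size u)%N.
      elim: m => // m IH; have [mu|mu] := ltnP m (size u).
        exact: leq_trans (size_code_le _ _) mu.
      have wm : w m = false by rewrite -wE nth_default.
      by rewrite size_code wm.
    by have [m] := wn (size u).+1; rewrite ltnNge bound.
  - have /asboolP/(_ v) := lv 0%N; rewrite vE => nh; exfalso.
    by apply: nh; exists w.
apply/seteqP; split=> r; first by move=> [i [v [_ <-]]].
(* Closedness lets a [y] with [f y] outside [range h] be caught by a whole node mapped outside
   it. *)
have cl : closed (range h).
  apply: compact_closed; first exact: (@norm_hausdorff _ R^o).
  apply: continuous_compact; last exact: cantor_space_compact.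
  exact: continuous_subspaceT.
move=> Sr; have [[w _ <-]|nr] := pselect (range h r).
  have [[M wM]|/forallNP wM] := pselect (exists M, forall m, (M <= m)%N -> ~~ w m).
    exists (inl (inr (mkseq w M))), (fun=> 0%N); split=> //=; congr h.
    apply/funext => i; have [iM|Mi] := ltnP i M; first by rewrite nth_mkseq.
    by rewrite nth_default ?size_mkseq// (negbTE (wM _ Mi)).
  have wn : forall n, exists m, (n <= size (code w m).1)%N.
    apply: code_unbounded => M; have /existsNP[m /not_implyP[Mm /negP]] := wM M.
    by rewrite negbK; exists m.
  have [x wx] := code_branch wn; have [y xy] := (BP t).1 Bt x.
  pose v : baire := fun i => pair_code (w i) (y i).
  have vw : bits v = w.
    by apply/funext => i; rewrite /bits /v pair_codeK; case: (w i).
  exists (inl (inl tt)), v; split=> [n|]; last by rewrite /phi vw.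
  have wxn : (code (bits v) n).1 = mkseq x (size (code (bits v) n).1).
    by rewrite vw; exact: wx.
  have -> : live (inl (inl tt)) t (mkseq v n) = _ := liveE v x n wxn.
  rewrite (_ : (fun i => (decode (v i)).2) = y); first exact: xy.
  by apply/funext => i; rewrite /v pair_codeK.
move: Sr nr; rewrite -fS => -[y _ <-] nr.
have : nbhs y (f @^-1` (~` range h)).
  by apply: fc; apply: open_nbhs_nbhs; split=> //; rewrite openC.
move=> /(@nbhs_agreeP nat)[n yn].
have cy : concat (mkseq y n) (fun i => y (n + i)%N) = y.
  apply/funext => i; rewrite /concat size_mkseq; case: ltnP => i_n.
    by rewrite nth_mkseq.
  by rewrite subnKC.
exists (inr (mkseq y n)), (fun i => y (n + i)%N); split=> [k|]; last by rewrite /phi cy.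
apply/asboolP => v; apply: yn => i i_n.
by rewrite /concat size_mkseq i_n nth_mkseq.
Qed.

End UncountableHardness.

Unset Implicit Arguments.

Theorem theorem6p3 (R : realType) (S : set R) :
  S `<=` `]0, 1[ -> analytic S ->
  [/\ S = set0 ->
        Gamma_complete (R := R) (@coanalytic) (R_S S),
      S !=set0 -> countable S ->
        Gamma_complete (R := R) (@d2Sigma11) (R_S S)
    & ~ countable S ->
        Gamma_complete (R := R) (@Pi12) (R_S S)].
Proof.
move=> S01 aS; split=> [->|S0 cS|nS].
- by split; [exact: empty_R_S_coanalytic|move=> Z zZ B; exact: empty_R_S_hard].
- split; first exact: countable_R_S_d2Sigma11.
  by move=> Z zZ B; exact: countable_R_S_hard.
- split; last by move=> Z zZ B; exact: uncountable_R_S_hard.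
  apply: analytic_R_S_Pi12 => //; apply/set0P/eqP => SE.
  by apply: nS; rewrite SE.
Qed.
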